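(* Let $m\geq 2$ and $n>2m-1$. Then $\pi_n(\mathbb{E}_m)$ contains a subgroup isomorphic to \[\prod_{\mathbb{N}}\pi_n(S^m)\ \oplus \bigoplus_{2\leq j\leq \frac{n-1}{m-1}}\left(\prod_{\mathbb{N}}\bigoplus_{\mathbb{N}}\pi_{n}(S^{mj-j+1})\right)\] on which the canonical homomorphism $\Psi_{n}:\pi_n(\mathbb{E}_m)\to \check{\pi}_{n}(\mathbb{E}_m)$ is injective.
   Context: For $m\geq 2$, $\mathbb{E}_m$ is the shrinking wedge of countably many $m$-spheres $S^m_1,S^m_2,\dots$: the one-point union with wedgepoint $b_0$, where $U$ is open iff $U\cap S^m_j$ is open in $S^m_j$ for every $j$ and, if $b_0\in U$, then $S^m_j\subseteq U$ for all but finitely many $j$. Let $X_{\leq k}=\bigvee_{j=1}^{k}S^m_j$, $b_{k+1,k}:X_{\leq k+1}\to X_{\leq k}$ the map collapsing the $(k+1)$-st sphere, $b_k:\mathbb{E}_m\to X_{\leq k}$ the map collapsing $\bigcup_{j>k}S^m_j$. Then $\check{\pi}_n(\mathbb{E}_m)=\varprojlim_k(\pi_n(X_{\leq k}),(b_{k+1,k})_\#)$ and $\Psi_n([f])=([b_k\circ f])_{k}$. $\prod_{\mathbb{N}}$ and $\bigoplus_{\mathbb{N}}$ denote countably infinite direct products and direct sums. *)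

(* Defs.v *)
From HB Require Import structures.
From mathcomp Require Import all_boot all_order all_algebra.
From mathcomp Require Import all_classical all_reals topology normedtype.

Import Order.TTheory GRing.Theory Num.Theory.
Import numFieldNormedType.Exports.
Local Open Scope ring_scope.
Local Open Scope classical_set_scope.

Section HomotopyDefs.
Variable R : realType.

Definition unitI : set R := [set t | 0 <= t <= 1].
Definition cube n : set 'rV[R]_n := [set x | forall i, 0 <= x ord0 i <= 1].
Definition cube_bd n : set 'rV[R]_n :=
  [set x | exists i, x ord0 i = 0 \/ x ord0 i = 1].

Definition is_nloop n d (A : set 'rV[R]_d) (p : 'rV[R]_d)
    (f : 'rV[R]_n -> 'rV[R]_d) : Prop :=
  [/\ {within (cube n), continuous f},
      (forall x, (cube n) x -> A (f x)) &
      (forall x, (cube n) x -> (cube_bd n) x -> f x = p)].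

(* Homotopy rel boundary of n-loops in (A, p): equality in pi_n(A, p). *)
Definition nhtp n d (A : set 'rV[R]_d) (p : 'rV[R]_d)
    (f g : 'rV[R]_n -> 'rV[R]_d) : Prop :=
  exists H : R * 'rV[R]_n -> 'rV[R]_d,
  [/\ {within unitI `*` (cube n), continuous H},
      (forall t x, unitI t -> (cube n) x -> A (H (t, x))),
      (forall x, (cube n) x -> H (0, x) = f x),
      (forall x, (cube n) x -> H (1, x) = g x) &
      (forall t x, unitI t -> (cube n) x -> (cube_bd n) x -> H (t, x) = p)].

Definition fcoord n (x : 'rV[R]_n) : R := \sum_(i < n | val i == 0%N) x ord0 i.
Definition set_fcoord n (x : 'rV[R]_n) (t : R) : 'rV[R]_n :=
  \row_i (if val i == 0%N then t else x ord0 i).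
Definition concat n d (f g : 'rV[R]_n -> 'rV[R]_d) : 'rV[R]_n -> 'rV[R]_d :=
  fun x => if fcoord n x <= 2^-1 then f (set_fcoord n x (2 * fcoord n x))
           else g (set_fcoord n x (2 * fcoord n x - 1)).

Definition sqn d (x : 'rV[R]_d) : R := \sum_(i < d) x ord0 i ^+ 2.
Definition e0 k : 'rV[R]_k.+1 := \row_i (i == ord0)%:R.
Definition sphere k : set 'rV[R]_k.+1 := [set x | sqn k.+1 x = 1].

(* The shrinking wedge E_m, realised in R^(m+1): the j-th sphere (j >= 1) is
   the m-sphere of radius 1/j centred at (1/j) e_0; they meet only at 0. *)
Definition wsphere m (j : nat) : set 'rV[R]_m.+1 :=
  [set x | sqn m.+1 (x - j%:R^-1 *: e0 m) = j%:R^-1 ^+ 2].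
Definition Em m : set 'rV[R]_m.+1 := [set x | exists j, (0 < j)%N /\ wsphere m j x].
(* X_{<=k} = S_1 v ... v S_k (the point 0 for k = 0). *)
Definition Xle m k : set 'rV[R]_m.+1 :=
  [set x | x = 0 \/ exists j, (0 < j <= k)%N /\ wsphere m j x].
Definition bk m k (x : 'rV[R]_m.+1) : 'rV[R]_m.+1 :=
  if `[< exists j, (0 < j <= k)%N /\ wsphere m j x >] then x else 0.

(* The group  prod_N pi_n(S^m) (+) (+)_{2<=j<=(n-1)/(m-1)} prod_N (+)_N pi_n(S^{mj-j+1})
   in terms of representatives: an element is a pair (a, c) with a i an n-loop
   in S^m and c j i l an n-loop in S^{(m-1)j+1}. *)
Definition Gtype n m := ((nat -> 'rV[R]_n -> 'rV[R]_m.+1) *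
  (forall j : nat, nat -> nat -> 'rV[R]_n -> 'rV[R]_((m - 1) * j + 1).+1))%type.

Definition jrange n m (j : nat) : bool := (2 <= j)%N && (j * (m - 1) <= n - 1)%N.

Definition G_valid n m (g : Gtype n m) : Prop :=
  (forall i, is_nloop n m.+1 (sphere m) (e0 m) (g.1 i)) /\
  (forall j, jrange n m j ->
     (forall i l, is_nloop n _ (sphere _) (e0 _) (g.2 j i l)) /\
     (* direct sum over l: for each i, all but finitely many classes trivial *)
     (forall i, exists N, forall l, (N <= l)%N ->
        nhtp n _ (sphere _) (e0 _) (g.2 j i l) (fun _ => e0 _))).

Definition G_eq n m (g h : Gtype n m) : Prop :=
  (forall i, nhtp n m.+1 (sphere m) (e0 m) (g.1 i) (h.1 i)) /\
  (forall j, jrange n m j -> forall i l,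
     nhtp n _ (sphere _) (e0 _) (g.2 j i l) (h.2 j i l)).

Definition G_add n m (g h : Gtype n m) : Gtype n m :=
  (fun i => concat n m.+1 (g.1 i) (h.1 i), fun j i l => concat n _ (g.2 j i l) (h.2 j i l)).

End HomotopyDefs.

(* Main.v *)
Require Import Defs.
From HB Require Import structures.
From mathcomp Require Import all_boot all_order all_algebra.
From mathcomp Require Import all_classical all_reals topology normedtype.
From mathcomp Require Import ring lra.
Import Order.TTheory GRing.Theory Num.Theory.
Import numFieldNormedType.Exports.
Local Open Scope ring_scope.
Local Open Scope classical_set_scope.

(** For each j, an iterated Whitehead product w of j inclusions maps the sphere
S of dimension (m - 1) j + 1 to a wedge of j spheres of dimension m, and w is
injective on homotopy groups because it has an explicit left inverse of
James-Hopf type.  For f = (f_1, f_2) with values in S^p v S^q, regard S^p as a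
suspension and write f_1(t, z) = (s, a) with suspension coordinate s; the
invariant of f is the map (t, z) |-> a /\ f_2(s t, z) with values in
S^(p-1) /\ S^q = S^(p+q-1).  It is continuous because f_2 vanishes at time 0,
and at time t whenever f_1(t, z) is not the base point.  On the image of the
Whitehead product it is homotopic to the identity, naturally enough to be
iterated over the j factors.

The countably many summands are carried by pairwise disjoint families of
spheres of E_m, so that an arbitrary family of classes has an infinite
concatenation, and collapsing all spheres outside one family recovers each
summand. *)

Set Implicit Arguments.
Unset Strict Implicit.
Unset Printing Implicit Defensive.

(** A null-homotopy in E_m may sweep through all spheres at once, so the left inverse is a formula
    applied to maps, and hence to homotopies as well; only its effect on the image of the Whitehead
    product has to be known. The formula is computable because spheres are written in stereographic
    coordinates with the base point at infinity: a smash product is then a concatenation of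
    coordinate vectors. Collapsing the complement of a box makes the invariant of the Whitehead
    product equal, on the nose, to a collapse map that is visibly homotopic to the identity. The
    time of a path is obtained by scaling the first cube coordinate. Infinite sums are laid out
    along the second one, so that they commute strictly with concatenation; this is where [n >= 2]
    enters. Each family has finitely many spheres and therefore survives in a single X_{<=k}.
    Injectivity is thus proved under Psi, and injectivity into the homotopy group of E_m follows
    from it. *)

Section Continuity.

(** * Closure rules for continuity at a point *)

Variables (R : realType) (T : topologicalType).
Implicit Types (x : T) (d : nat).

Lemma cts_cst (U : topologicalType) (c : U) x : continuous_at x (fun _ : T => c).
Proof. exact: cst_continuous. Qed.

Lemma cts_id x : continuous_at x (fun y : T => y).
Proof. by move=> A. Qed.

Lemma ctsD (f g : T -> R) x : continuous_at x f -> continuous_at x g ->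
  continuous_at x (fun y => f y + g y).
Proof. by move=> cf cg; apply: cvgD. Qed.

Lemma ctsN (f : T -> R) x : continuous_at x f ->
  continuous_at x (fun y => - f y).
Proof. by move=> cf; apply: cvgN. Qed.

Lemma ctsM (f g : T -> R) x : continuous_at x f -> continuous_at x g ->
  continuous_at x (fun y => f y * g y).
Proof. by move=> cf cg; apply: cvgM. Qed.

Lemma ctsX (f : T -> R) n x : continuous_at x f ->
  continuous_at x (fun y => f y ^+ n).
Proof.
move=> cf; elim: n => [|n IH]; first exact: cts_cst.
by under eq_fun do rewrite exprS; apply: ctsM.
Qed.

Lemma ctsV (f : T -> R) x : f x != 0 -> continuous_at x f ->
  continuous_at x (fun y => (f y)^-1).
Proof. by move=> f0 cf; apply: cvgV. Qed.

Lemma cts_abs (f : T -> R) x : continuous_at x f ->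
  continuous_at x (fun y => `|f y|).
Proof. by move=> cf; apply: cvg_norm. Qed.

Lemma cts_min (f g : T -> R) x : continuous_at x f -> continuous_at x g ->
  continuous_at x (fun y => Num.min (f y) (g y)).
Proof. by move=> cf cg; apply: (@continuous_min R T f g). Qed.

Lemma cts_max (f g : T -> R) x : continuous_at x f -> continuous_at x g ->
  continuous_at x (fun y => Num.max (f y) (g y)).
Proof. by move=> cf cg; apply: (@continuous_max R T f g). Qed.

Lemma cts_sum (I : Type) (r : seq I) (P : pred I) (f : I -> T -> R) x :
  (forall i, continuous_at x (f i)) ->
  continuous_at x (fun y => \sum_(i <- r | P i) f i y).
Proof.
move=> cf; elim: r => [|i r IH].
  by under eq_fun do rewrite big_nil; apply: cts_cst.
by under eq_fun do rewrite big_cons; case: (P i) => //; apply: ctsD.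
Qed.

Lemma cts_pair (U V : topologicalType) (f : T -> U) (g : T -> V) x :
  continuous_at x f -> continuous_at x g ->
  continuous_at x (fun y => (f y, g y)).
Proof. by move=> cf cg; apply: cvg_pair. Qed.

Lemma cts_comp (U V : topologicalType) (g : U -> V) (f : T -> U) x :
  continuous_at (f x) g -> continuous_at x f ->
  continuous_at x (fun y => g (f y)).
Proof. by move=> cg cf; apply: (continuous_comp cf cg). Qed.

Lemma cts_fst (U V : topologicalType) (f : T -> U * V) x :
  continuous_at x f -> continuous_at x (fun y => (f y).1).
Proof. by apply: (@cts_comp _ _ fst); apply: cvg_fst. Qed.

Lemma cts_snd (U V : topologicalType) (f : T -> U * V) x :
  continuous_at x f -> continuous_at x (fun y => (f y).2).
Proof. by apply: (@cts_comp _ _ snd); apply: cvg_snd. Qed.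

Lemma cts_coord m n (f : T -> 'M[R]_(m, n)) i j x :
  continuous_at x f -> continuous_at x (fun y => f y i j).
Proof. by apply: (@cts_comp _ _ (fun A : 'M[R]_(m, n) => A i j)); apply: coord_continuous. Qed.

Lemma cts_row d (f : T -> 'rV[R]_d) x :
  (forall i, continuous_at x (fun y => f y ord0 i)) -> continuous_at x f.
Proof.
move=> cf A [P nP sPA].
have : \near x, forall i : 'I_d, P ord0 i (f x ord0 i).
  by apply: filter_forall => i; apply: cf; apply: nP.
by apply: filterS => y Py; apply: sPA => i j; rewrite ord1.
Qed.

Lemma cts_rowE d (f : 'I_d -> T -> R) x :
  (forall i, continuous_at x (f i)) -> continuous_at x (fun y => \row_i f i y).
Proof.
move=> cf; apply: cts_row => i.
by rewrite (_ : (fun y => _) = f i) //; apply/funext => y; rewrite mxE.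
Qed.

Lemma cts_near_eq (U : topologicalType) (f g : T -> U) x :
  (\near x, f x = g x) -> continuous_at x g -> continuous_at x f.
Proof.
move=> fg cg; rewrite /continuous_at (nbhs_singleton fg).
apply: cvg_trans cg; apply: near_eq_cvg.
by apply: filterS fg => y ->.
Qed.

Lemma cts_eq (U : topologicalType) (f g : T -> U) x :
  (forall y, f y = g y) -> continuous_at x g -> continuous_at x f.
Proof. by move=> /funext ->. Qed.

Lemma cts_near_cst (U : topologicalType) (f : T -> U) (c : U) x :
  (\near x, f x = c) -> continuous_at x f.
Proof. by move=> fc; apply: cts_near_eq fc (@cts_cst _ _ _). Qed.

Lemma near_neq d (f : T -> 'rV[R]_d) p x : continuous_at x f -> f x != p ->
  \near x, f x != p.
Proof.
move=> cf np; have [i npi] : exists i, f x ord0 i != p ord0 i.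
  apply/existsP; apply: contraNT np => /existsPn h; apply/eqP/rowP => i.
  by have := h i; rewrite negbK => /eqP.
have c2 : continuous_at x (fun y => `|f y ord0 i - p ord0 i|).
  by apply/cts_abs/ctsD; [apply: cts_coord|apply: cts_cst].
have := cvgr_gt _ c2 0; rewrite normr_gt0 subr_eq0 => /(_ _ npi).
by apply: filterS => y; rewrite normr_gt0 subr_eq0; apply: contra => /eqP ->.
Qed.

Lemma near_lt (f g : T -> R) x : continuous_at x f -> continuous_at x g ->
  f x < g x -> \near x, f x < g x.
Proof.
move=> cf cg h; have := cvgr_gt _ (ctsD cg (ctsN cf)) 0; rewrite subr_gt0.
by move=> /(_ _ h); apply: filterS => y; rewrite subr_gt0.
Qed.

Lemma cts_glue (U : topologicalType) (f g : T -> U) (l : T -> R) x :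
  continuous_at x f -> continuous_at x g -> continuous_at x l ->
  (l x = 0 -> f x = g x) ->
  continuous_at x (fun y => if l y <= 0 then f y else g y).
Proof.
move=> cf cg cl fg; have [l0|l0|l0] := ltrgt0P (l x).
- apply: (cts_near_eq (g := g)) => //.
  have := near_lt (@cts_cst R^o 0 x) cl l0; apply: filterS => y ly.
  by rewrite leNgt ly.
- apply: (cts_near_eq (g := f)) => //.
  have := near_lt cl (@cts_cst R^o 0 x) l0; apply: filterS => y ly.
  by rewrite ltW.
- move=> A; rewrite /= l0 lexx => Af.
  have Ag : nbhs (g x) A by rewrite -fg.
  have hf : \near x, A (f x) := cf _ Af.
  have hg : \near x, A (g x) := cg _ Ag.
  suff : \near x, A (if l x <= 0 then f x else g x) by [].
  by near=> y; case: ifP => _; near: y.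
Unshelve. all: by end_near. Qed.

End Continuity.

(** Descends along the syntax of the function. The rule for constants precedes the other syntactic
    rules, so subterms without the variable are closed at once; goals that match no rule are left to
    the caller. *)
Ltac cts := first [assumption | lazymatch goal with
  | |- continuous_at _ (fun _ => ?c) => exact: cts_cst
  | |- continuous_at _ (fun y => y) => exact: cts_id
  | |- continuous_at _ (fun y => @?f y + @?g y) => apply: (@ctsD _ _ f g); cts
  | |- continuous_at _ (fun y => - @?f y) => apply: (@ctsN _ _ f); cts
  | |- continuous_at _ (fun y => @?f y * @?g y) => apply: (@ctsM _ _ f g); cts
  | |- continuous_at _ (fun y => @?f y ^+ _) => apply: (@ctsX _ _ f); cts
  | |- continuous_at _ (fun y => `|@?f y|) => apply: (@cts_abs _ _ f); cts
  | |- continuous_at _ (fun y => Num.min (@?f y) (@?g y)) => apply: (@cts_min _ _ f g); cts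
  | |- continuous_at _ (fun y => Num.max (@?f y) (@?g y)) => apply: (@cts_max _ _ f g); cts
  | |- continuous_at _ (fun y => (@?f y, @?g y)) => apply: (@cts_pair _ _ _ f g); cts
  | |- continuous_at _ fst => exact: cvg_fst
  | |- continuous_at _ snd => exact: cvg_snd
  | |- continuous_at _ (fun y => (@?f y).1) => apply: (@cts_fst _ _ _ f); cts
  | |- continuous_at _ (fun y => (@?f y).2) => apply: (@cts_snd _ _ _ f); cts
  | |- continuous_at _ (fun y => fun_of_matrix (@?f y) _ _) => apply: (@cts_coord _ _ _ _ f); cts
  | |- continuous_at _ (fun y => \sum_(_ <- _ | _) _) => apply: cts_sum => ?; cts
  | |- _ => idtac
  end].

(** * Stereographic coordinates on spheres *)

Section Stereographic.
Variable R : realType.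
Local Notation sq := (sqn R _).
Local Notation base := (e0 R _).

Definition consv d (t : R) (a : 'rV[R]_d) : 'rV[R]_d.+1 :=
  \row_i oapp (fun j => a ord0 j) t (unlift ord0 i).
Definition tailv d (x : 'rV[R]_d.+1) : 'rV[R]_d := \row_j x ord0 (lift ord0 j).

Lemma consv0 d t (a : 'rV[R]_d) : consv t a ord0 ord0 = t.
Proof. by rewrite mxE unlift_none. Qed.

Lemma consvS d t (a : 'rV[R]_d) j : consv t a ord0 (lift ord0 j) = a ord0 j.
Proof. by rewrite mxE liftK. Qed.

Lemma consvK d t (a : 'rV[R]_d) : tailv (consv t a) = a.
Proof. by apply/rowP => j; rewrite mxE consvS. Qed.

Lemma consv_tail d (x : 'rV[R]_d.+1) : consv (x ord0 ord0) (tailv x) = x.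
Proof.
by apply/rowP => i; rewrite mxE; case: unliftP => [j ->|->] //=; rewrite mxE.
Qed.

Lemma sqn_ge0 d (x : 'rV[R]_d) : 0 <= sq x.
Proof. by apply: sumr_ge0 => i _; rewrite sqr_ge0. Qed.

Lemma sqn_coord d (x : 'rV[R]_d) i : x ord0 i ^+ 2 <= sq x.
Proof.
rewrite /sqn (bigD1 i) //= lerDl.
by apply: sumr_ge0 => j _; rewrite sqr_ge0.
Qed.

Lemma sqn_consv d t (a : 'rV[R]_d) : sq (consv t a) = t ^+ 2 + sq a.
Proof.
by rewrite /sqn big_ord_recl consv0; under eq_bigr do rewrite consvS.
Qed.

Lemma sqn_row_mx d1 d2 (a : 'rV[R]_d1) (b : 'rV[R]_d2) :
  sq (row_mx a b) = sq a + sq b.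
Proof.
rewrite /sqn big_split_ord /=.
by under eq_bigr do rewrite row_mxEl; under [X in _ + X]eq_bigr do rewrite row_mxEr.
Qed.

Lemma sqnZ d c (x : 'rV[R]_d) : sq (c *: x) = c ^+ 2 * sq x.
Proof. by rewrite /sqn mulr_sumr; apply: eq_bigr => i _; rewrite mxE exprMn. Qed.

Lemma sqn0P d (x : 'rV[R]_d) : sq x = 0 -> x = 0.
Proof.
move=> x0; apply/rowP => i; rewrite mxE; apply/eqP.
by rewrite -sqrf_eq0 eq_le sqr_ge0 -x0 sqn_coord.
Qed.

Lemma e0E d : base = consv 1 0 :> 'rV[R]_d.+1.
Proof.
by apply/rowP => i; rewrite !mxE; case: unliftP => [j ->|->] //=; rewrite mxE.
Qed.

Lemma e00 d : (base : 'rV[R]_d.+1) ord0 ord0 = 1.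
Proof. by rewrite mxE eqxx. Qed.

Lemma sphere_e0 d : sphere R d base.
Proof. by rewrite /sphere /= e0E sqn_consv /sqn big1 ?addr0 ?expr1n // => i _; rewrite mxE expr0n. Qed.

Lemma sphereE d (x : 'rV[R]_d.+1) : sphere R d x ->
  sq (tailv x) = (1 - x ord0 ord0) * (1 + x ord0 ord0).
Proof. by rewrite /sphere /= -{1}[x]consv_tail sqn_consv => h; rewrite -(addKr (x ord0 ord0 ^+ 2) (sq _)) h; ring. Qed.

Lemma sphere_coord d (x : 'rV[R]_d.+1) : sphere R d x -> -1 <= x ord0 ord0 <= 1.
Proof. move=> sx; have := sqn_coord x ord0; rewrite sx.
by move: (x ord0 ord0) => t; nra. Qed.

Lemma sphere_lt1 d (x : 'rV[R]_d.+1) : sphere R d x -> x != base -> x ord0 ord0 < 1.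
Proof.
move=> sx nb; have /andP[_ x1] := sphere_coord sx.
rewrite lt_neqAle x1 andbT; apply: contra nb => /eqP x0.
apply/eqP; rewrite e0E -[x]consv_tail x0; congr consv.
by apply: sqn0P; rewrite sphereE // x0 subrr mul0r.
Qed.

(* Inverse stereographic projection; the point at infinity is [e0]. *)
Definition kap d (v : 'rV[R]_d) : 'rV[R]_d.+1 :=
  consv ((sq v - 1) / (sq v + 1)) ((2 / (sq v + 1)) *: v).
(** At [e0] the inverse of 0 is 0 and the value carries no information, whence the case distinctions
    on the base point below. *)
Definition ste d (x : 'rV[R]_d.+1) : 'rV[R]_d := (1 - x ord0 ord0)^-1 *: tailv x.

Lemma sqn1_gt0 d (v : 'rV[R]_d) : 0 < sq v + 1.
Proof. by rewrite ltr_wpDl ?sqn_ge0. Qed.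

(** The quantity [1 - x ord0 ord0] serves throughout as the distance to the base point; it is small
    exactly when the coordinate vector is long. *)
Lemma kap_height d (v : 'rV[R]_d) : 1 - kap v ord0 ord0 = 2 / (sq v + 1).
Proof. by rewrite consv0; have := sqn1_gt0 v; move: (sq v) => s s0; field; lra. Qed.

Lemma kap_sphere d (v : 'rV[R]_d) : sphere R d (kap v).
Proof.
rewrite /sphere /= sqn_consv sqnZ; have := sqn1_gt0 v; move: (sq v) => s s0.
by field; lra.
Qed.

Lemma kap_neq d (v : 'rV[R]_d) : kap v != base.
Proof.
apply/eqP => kb; have := kap_height v; rewrite kb e00 subrr => /esym/eqP.
by rewrite mulf_eq0 invr_eq0 (gt_eqF (sqn1_gt0 v)) orbF pnatr_eq0.
Qed.

Lemma kapK d (v : 'rV[R]_d) : ste (kap v) = v.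
Proof.
rewrite /ste kap_height consvK scalerA; have := sqn1_gt0 v; move: (sq v) => s s0.
rewrite (_ : _ * _ = 1) ?scale1r //; field; lra.
Qed.

Lemma sqn_ste d (x : 'rV[R]_d.+1) : sphere R d x -> x != base ->
  sq (ste x) + 1 = 2 / (1 - x ord0 ord0).
Proof.
move=> sx nb; rewrite sqnZ sphereE //; have := sphere_lt1 sx nb.
by move: (x ord0 ord0) => t t1; field; lra.
Qed.

Lemma steK d (x : 'rV[R]_d.+1) : sphere R d x -> x != base -> kap (ste x) = x.
Proof.
move=> sx nb; rewrite /kap (_ : sq (ste x) - 1 = sq (ste x) + 1 - 2); last by ring.
rewrite !sqn_ste // /ste scalerA -[RHS]consv_tail.
have := sphere_lt1 sx nb; move: (x ord0 ord0) => t t1; congr consv.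
  by field; lra.
by rewrite (_ : _ * _ = 1) ?scale1r //; field; lra.
Qed.

Section Continuity.
Variable T : topologicalType.
Implicit Types x : T.

Lemma cts_consv d (t : T -> R) (f : T -> 'rV[R]_d) x :
  continuous_at x t -> continuous_at x f ->
  continuous_at x (fun y => consv (t y) (f y)).
Proof.
move=> ct cf; apply: cts_row => i; case: (unliftP ord0 i) => [j ->|->].
  by apply: (cts_eq (fun y => consvS (t y) (f y) j)); cts.
by apply: (cts_eq (fun y => consv0 (t y) (f y))).
Qed.

Lemma cts_tailv d (f : T -> 'rV[R]_d.+1) x :
  continuous_at x f -> continuous_at x (fun y => tailv (f y)).
Proof. by move=> cf; apply: cts_row => i; apply: (cts_eq (fun y => mxE _ _ _ _)); cts. Qed.

Lemma cts_sqn d (f : T -> 'rV[R]_d) x :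
  continuous_at x f -> continuous_at x (fun y => sq (f y)).
Proof. by move=> cf; rewrite /sqn; cts. Qed.

Lemma cts_scale d (t : T -> R) (f : T -> 'rV[R]_d) x :
  continuous_at x t -> continuous_at x f -> continuous_at x (fun y => t y *: f y).
Proof. by move=> ct cf; apply: cts_row => i; apply: (cts_eq (fun y => mxE _ _ _ _)); cts. Qed.

Lemma cts_row_mx d1 d2 (f : T -> 'rV[R]_d1) (g : T -> 'rV[R]_d2) x :
  continuous_at x f -> continuous_at x g ->
  continuous_at x (fun y => row_mx (f y) (g y)).
Proof.
move=> cf cg; apply: cts_row => i; case: (split_ordP i) => j ->.
  by apply: (cts_eq (fun y => row_mxEl (f y) (g y) ord0 j)); cts.
by apply: (cts_eq (fun y => row_mxEr (f y) (g y) ord0 j)); cts.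
Qed.

Lemma cts_lsubmx d1 d2 (f : T -> 'rV[R]_(d1 + d2)) x :
  continuous_at x f -> continuous_at x (fun y => lsubmx (f y)).
Proof. by move=> cf; apply: cts_row => i; apply: (cts_eq (fun y => mxE _ _ _ _)); cts. Qed.

Lemma cts_rsubmx d1 d2 (f : T -> 'rV[R]_(d1 + d2)) x :
  continuous_at x f -> continuous_at x (fun y => rsubmx (f y)).
Proof. by move=> cf; apply: cts_row => i; apply: (cts_eq (fun y => mxE _ _ _ _)); cts. Qed.

Lemma cts_kap d (f : T -> 'rV[R]_d) x :
  continuous_at x f -> continuous_at x (fun y => kap (f y)).
Proof.
move=> cf; have cs := cts_sqn cf.
have cv : continuous_at x (fun y => (sq (f y) + 1)^-1).
  by apply: ctsV; [rewrite gt_eqF ?sqn1_gt0 | cts].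
by rewrite /kap; apply: cts_consv; [cts | apply: cts_scale => //; cts].
Qed.

Lemma cts_ste d (f : T -> 'rV[R]_d.+1) x : sphere R d (f x) -> f x != base ->
  continuous_at x f -> continuous_at x (fun y => ste (f y)).
Proof.
move=> sx nb cf; rewrite /ste; apply: cts_scale; last exact: cts_tailv.
by apply: ctsV; [have := sphere_lt1 sx nb; lra | cts].
Qed.

(** On the sphere the squares of the other coordinates add up to [(1 - t) * (1 + t) <= 2 * (1 - t)],
    where [t] is the first coordinate. So [1 - t] alone controls convergence to the base point, and
    [1 - t < e ^+ 2 / 2] gives precision [e]. *)
Lemma cts_base d (f : T -> 'rV[R]_d.+1) x : (forall y, sphere R d (f y)) ->
  f x = base -> (forall e : R, 0 < e -> \near x, 1 - f x ord0 ord0 < e) ->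
  continuous_at x f.
Proof.
move=> sf fx hf; apply: cts_row => i; rewrite /continuous_at fx.
apply/cvgrPdist_lt => e egt0; case: (unliftP ord0 i) => [j ->|->].
  have e2 : 0 < e ^+ 2 / 2 by rewrite divr_gt0 ?exprn_gt0.
  have := hf _ e2; apply: filterS => y hy.
  rewrite e0E consvS mxE sub0r normrN -(@ltr_pXn2r _ 2) ?nnegrE ?normr_ge0 ?ltW //.
  rewrite real_normK ?num_real //.
  have := sqn_coord (tailv (f y)) j; rewrite mxE sphereE //.
  have /andP[] := sphere_coord (sf y).
  move: (f y ord0 ord0) (f y ord0 (lift ord0 j)) hy => t u; nra.
have := hf _ egt0; apply: filterS => y hy.
by rewrite e00 ger0_norm // subr_ge0; have /andP[] := sphere_coord (sf y).
Qed.

Lemma near_base d (f : T -> 'rV[R]_d.+1) x (e : R) : continuous_at x f ->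
  f x = base -> 0 < e -> \near x, 1 - f x ord0 ord0 < e.
Proof.
move=> cf fx e0; apply: (@near_lt _ _ (fun y => 1 - f y ord0 ord0) (fun=> e)); cts.
by rewrite fx e00 subrr.
Qed.

End Continuity.
End Stereographic.

(** * The box collapse and the smash-valued invariant *)

Section Twist.
Variable R : realType.
Local Notation sq := (sqn R _).
Local Notation base := (e0 R _).

(* At [th = 0] this is [kap]; at [th = 1] it collapses the complement of the
   open box [-1, 1]^d to the base point. *)
Definition kb d (th : R) (v : 'rV[R]_d) : 'rV[R]_d.+1 :=
  if [forall i, th * `|v ord0 i| < 1]
  then kap (\row_i (v ord0 i / (1 - th * `|v ord0 i|))) else base.

Lemma kb_sphere d th (v : 'rV[R]_d) : sphere R d (kb th v).
Proof. by rewrite /kb; case: ifP => _; [apply: kap_sphere | apply: sphere_e0]. Qed.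

Lemma kb_neq d th (v : 'rV[R]_d) :
  (kb th v != base) = [forall i, th * `|v ord0 i| < 1].
Proof. by rewrite /kb; case: ifP => _; rewrite ?eqxx ?kap_neq. Qed.

Lemma kb0 d (v : 'rV[R]_d) : kb 0 v = kap v.
Proof.
rewrite /kb ifT; last by apply/forallP => i; rewrite mul0r.
by congr kap; apply/rowP => i; rewrite mxE mul0r subr0 divr1.
Qed.

(** The denominators [1 - th * |v i|] lie in (0, 1], so the rescaled vector is at least as long as
    [v]. The bound is uniform in [th], which yields continuity of [kbase] at the base point. *)
Lemma kb_inf d th (v : 'rV[R]_d) : 0 <= th -> kb th v != base ->
  1 - kb th v ord0 ord0 <= 2 / (sq v + 1).
Proof.
move=> th0; rewrite kb_neq => hv; rewrite /kb hv kap_height.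
rewrite ler_pM2l // lef_pV2 ?posrE ?sqn1_gt0 // lerD2r.
apply: ler_sum => i _; rewrite mxE exprMn ler_peMr ?sqr_ge0 //.
have := forallP hv i => hi; rewrite exprVn -[leLHS]invr1 lef_pV2 ?posrE //.
  have := mulr_ge0 th0 (normr_ge0 (v ord0 i)); move: hi; move: (th * _) => a a1 a0.
  by nra.
by rewrite exprn_gt0 // subr_gt0.
Qed.

Section Continuity.
Variable T : topologicalType.
Implicit Types x : T.

(** At a critical point [th * |v i| >= 1] for some [i]. Nearby values are the base point or have the
    [i]-th coordinate divided by a small number, hence a long coordinate vector. *)
Lemma cts_kb d (th : T -> R) (v : T -> 'rV[R]_d) x :
  (forall y, 0 <= th y <= 1) -> continuous_at x th -> continuous_at x v ->
  continuous_at x (fun y => kb (th y) (v y)).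
Proof.
move=> th01 cth cv.
have cD i : continuous_at x (fun y => 1 - th y * `|v y ord0 i|) by cts.
case: (boolP [forall i, th x * `|v x ord0 i| < 1]) => [/forallP hx|hx].
  pose f y := kap (\row_i (v y ord0 i / (1 - th y * `|v y ord0 i|))).
  apply: (cts_near_eq (g := f)).
    have : \near x, forall i, th x * `|v x ord0 i| < 1.
      by apply: filter_forall => i; apply: (@near_lt _ _ _ (fun=> 1)) => //; cts.
    apply: filterS => y hy; rewrite /kb ifT //; exact/forallP.
  apply: cts_kap; apply: cts_rowE => i.
  have hD : 1 - th x * `|v x ord0 i| != 0 by rewrite gt_eqF ?subr_gt0.
  have cV : continuous_at x (fun y => (1 - th y * `|v y ord0 i|)^-1) by apply: ctsV.
  by cts.
apply: cts_base => [y||e e0]; first exact: kb_sphere.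
  by rewrite /kb (negbTE hx).
move: hx; rewrite negb_forall => /existsP[i]; rewrite -leNgt => hi.
have vi : 2^-1 < `|v x ord0 i|.
  have /andP[? ?] := th01 x; have := normr_ge0 (v x ord0 i).
  by move: hi; move: `|_| => a; nra.
have n1 : \near x, 2^-1 < `|v x ord0 i|.
  by apply: (@near_lt _ _ (fun=> 2^-1)) => //; cts.
(* With [D] this small denominator and [S] the squared length, [|v i| > 1/2] gives
   [S * D ^+ 2 > 1/4], hence [S * D > 1/4] because [D < 1]. Then [D < e / 8] gives [S > 2 / e], so
   the height [2 / (S + 1)] is below [e]. *)
have n2 : \near x, 1 - th x * `|v x ord0 i| < Num.min 1 (e / 8).
  apply: (near_lt (g := fun=> Num.min 1 (e / 8)) (cD i)); first by cts.
  rewrite lt_min; apply/andP; split; first by nra.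
  by apply: le_lt_trans (_ : 0 < _); [lra | rewrite divr_gt0].
near=> y; have : 2^-1 < `|v y ord0 i| by near: y.
have : 1 - th y * `|v y ord0 i| < Num.min 1 (e / 8) by near: y.
rewrite lt_min /kb => /andP[D1 De] vy; case: ifP => [/forallP hy|_]; last first.
  by rewrite e00 subrr.
rewrite kap_height ltr_pdivrMr ?sqn1_gt0 //.
set w := \row__ _; have := sqn_coord w i; rewrite mxE exprMn.
have := hy i; rewrite -subr_gt0; move: D1 De.
rewrite -(real_normK (num_real (v y ord0 i))).
move: (sq w) vy; set a := `|v y ord0 i|; set D := 1 - _ => S va D1 De D0.
have va2 : 4^-1 < a ^+ 2 by nra.
have DV : D^-1 * D = 1 by rewrite mulVf // gt_eqF.
rewrite exprVn => hS.
have : a ^+ 2 <= S * D ^+ 2.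
  by rewrite -ler_pdivrMr // exprn_gt0.
move=> h; have S0 : 0 <= S by nra.
have SD : 4^-1 < S * D by nra.
by nra.
Unshelve. all: by end_near. Qed.

End Continuity.

Lemma ste_height d (x : 'rV[R]_d.+1) : sphere R d x -> x != base ->
  2 / (sq (ste x) + 1) = 1 - x ord0 ord0.
Proof. by move=> sx nb; rewrite -kap_height steK. Qed.

(** Concatenation of coordinates models the smash product: the result approaches infinity as soon as
    one factor does. *)
Lemma kap_row_le d1 d2 (a : 'rV[R]_d1) (b : 'rV[R]_d2) :
  1 - kap (row_mx a b) ord0 ord0 <= 2 / (sq a + 1) /\
  1 - kap (row_mx a b) ord0 ord0 <= 2 / (sq b + 1).
Proof.
rewrite kap_height sqn_row_mx; have := sqn_ge0 a; have := sqn_ge0 b.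
by split; rewrite ler_pM2l // lef_pV2 ?posrE ?sqn1_gt0; lra.
Qed.

Definition kbase d th (x : 'rV[R]_d.+1) : 'rV[R]_d.+1 :=
  if x == base then base else kb th (ste x).

Lemma kbase_sphere d th (x : 'rV[R]_d.+1) : sphere R d (kbase th x).
Proof. by rewrite /kbase; case: ifP => _; [apply: sphere_e0 | apply: kb_sphere]. Qed.

Lemma kbase0 d (x : 'rV[R]_d.+1) : sphere R d x -> kbase 0 x = x.
Proof. by rewrite /kbase => sx; case: eqVneq => // nb; rewrite kb0 steK. Qed.

Lemma kbase_base d th : kbase th base = base :> 'rV[R]_d.+1.
Proof. by rewrite /kbase eqxx. Qed.

Lemma cts_kbase d (T : topologicalType) (th : T -> R) (c : T -> 'rV[R]_d.+1) x :
  (forall y, 0 <= th y <= 1) -> (forall y, sphere R d (c y)) ->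
  continuous_at x th -> continuous_at x c ->
  continuous_at x (fun y => kbase (th y) (c y)).
Proof.
move=> th01 sc cth cc; have [cx|cx] := eqVneq (c x) base.
  apply: cts_base => [y||e egt0]; [exact: kbase_sphere|by rewrite cx kbase_base|].
  have := near_base cc cx egt0; apply: filterS => y; apply: le_lt_trans.
  rewrite {1}/kbase; case: eqVneq => [->//|nb].
  have [->|kn] := eqVneq (kb (th y) (ste (c y))) base.
    by rewrite e00 subrr subr_ge0; have /andP[] := sphere_coord (sc y).
  have /andP[t0 _] := th01 y; rewrite -(ste_height (sc y) nb); exact: kb_inf.
apply: (cts_near_eq (g := fun y => kb (th y) (ste (c y)))).
  by have := near_neq cc cx; apply: filterS => y ny; rewrite /kbase (negbTE ny).
by apply: cts_kb => //; apply: cts_ste.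
Qed.

(** An increasing bijection from the line onto (0, 1), turning a suspension coordinate into a time.
    It is chosen to undo the box stretching [p / (1 - |p|)] up to an affine change. *)
Definition sg (s : R) : R := (1 + s / (1 + `|s|)) / 2.

Lemma sg_tail s d : 0 < d -> d^-1 < `|s| -> `|sg s| < d \/ `|sg s - 1| < d.
Proof.
move=> d0 ds; have dV : d^-1 * d = 1 by rewrite mulVf // gt_eqF.
have dV0 : 0 < d^-1 by rewrite invr_gt0.
rewrite /sg; have [s0|s0] := leP 0 s; move: ds.
  rewrite ger0_norm // => ds; right.
  rewrite (_ : _ - 1 = - (2 * (1 + s))^-1); last by field; lra.
  rewrite normrN gtr0_norm ?invr_gt0; last by lra.
  rewrite invf_plt ?posrE //; lra.
rewrite ltr0_norm // => ds; left.
rewrite (_ : _ / 2 = (2 * (1 - s))^-1); last by field; lra.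
rewrite gtr0_norm ?invr_gt0; last by lra.
rewrite invf_plt ?posrE //; lra.
Qed.

(* Writing the sphere of dimension m + 1 as a reduced suspension, [tw p b] is
   the image in a smash product of [a /\ b s], where [p = (s, a)]. *)
Definition tw m q (p : 'rV[R]_m.+2) (b : R -> 'rV[R]_q.+1) : 'rV[R]_(m + q).+1 :=
  if p == base then base else
  let y := b (sg (ste p ord0 ord0)) in
  if y == base then base else kap (row_mx (tailv (ste p)) (ste y)).

Lemma tw_sphere m q p b : sphere R (m + q) (@tw m q p b).
Proof.
rewrite /tw; case: ifP => _; first exact: sphere_e0.
by case: ifP => _; [exact: sphere_e0 | exact: kap_sphere].
Qed.

Lemma tw_base m q b : @tw m q base b = base.
Proof. by rewrite /tw eqxx. Qed.

(** Uniformity in [s] matters because the suspension coordinate of [f y] has no limit as [f y] tends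
    to the base point. *)
Lemma tube (T : topologicalType) (P : R * T -> Prop) s0 (x : T) :
  (\forall z \near (s0, x), P z) ->
  exists2 d, 0 < d & \near x, forall s, `|s - s0| < d -> P (s, x).
Proof.
case=> -[U V] [/= nU nV] sUV; have [d d0 dU] := (nbhs_normP s0 U).1 nU.
exists d => //; apply: filterS nV => y Vy s sd; apply: sUV; split => //=.
by apply: dU => /=; rewrite distrC.
Qed.

(** The delicate points have [f x = e0]. For [y] near [x], either the suspension coordinate of [f y]
    is large, so that the time is near 0 or 1 and [B] is near the base point, or the remaining
    coordinates of [f y] are large; both push the smash product to infinity. *)
Lemma cts_tw m q (T : topologicalType) (f : T -> 'rV[R]_m.+2)
    (B : R * T -> 'rV[R]_q.+1) :
  continuous f -> continuous B ->
  (forall x, sphere R m.+1 (f x)) -> (forall z, sphere R q (B z)) ->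
  (forall x, B (0, x) = base) -> (forall x, f x != base -> B (1, x) = base) ->
  continuous (fun x => tw (f x) (fun s => B (s, x))).
Proof.
move=> cf cB sf sB B0 B1 x; have [fx|fx] := eqVneq (f x) base; last first.
  pose s y := sg (ste (f y) ord0 ord0).
  have cs : continuous_at x s.
    have cv : continuous_at x (fun y => ste (f y)) by apply: cts_ste => //; apply: cf.
    rewrite /s /sg; apply: ctsM; cts; apply: ctsV; cts.
    by rewrite gt_eqF // ltr_pwDl.
  have cb : continuous_at x (fun y => B (s y, y)).
    by apply: (cts_comp (g := B) (f := fun y => (s y, y))); [apply: cB | cts].
  have nf := near_neq (cf x) fx.
  have [bx|bx] := eqVneq (B (s x, x)) base.
    apply: cts_base => [y||e egt0]; first exact: tw_sphere.
      by rewrite /tw (negbTE fx) /= -/(s x) bx eqxx.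
    have nb := near_base cb bx egt0; near=> y.
    have fy : f y != base by near: y.
    have : 1 - B (s y, y) ord0 ord0 < e by near: y.
    apply: le_lt_trans; rewrite /tw (negbTE fy) /= -/(s y).
    case: eqVneq => [->|by0]; first by rewrite !e00.
    rewrite -(ste_height (sB _) by0); exact: (kap_row_le _ _).2.
  apply: (cts_near_eq (g := fun y => kap (row_mx (tailv (ste (f y))) (ste (B (s y, y)))))).
    have nb := near_neq cb bx; near=> y.
    have h1 : f y != base by near: y.
    have h2 : B (s y, y) != base by near: y.
    by rewrite /tw (negbTE h1) /= -/(s y) (negbTE h2).
  apply: cts_kap; apply: cts_row_mx; first exact: cts_tailv (cts_ste (sf x) fx (cf x)).
  exact: cts_ste.
apply: cts_base => [y||e egt0]; [exact: tw_sphere | by rewrite fx tw_base |].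
(* If [B (1, x)] is not the base point, neither is [B (1, y)] nearby; then [f y] must be the base
   point and [tw] is locally constant. *)
have [B1x|B1x] := eqVneq (B (1, x)) base; last first.
  have cb : continuous_at x (fun y => B (1, y)).
    by apply: (cts_comp (g := B) (f := fun y => (1 : R, y))); [apply: cB | cts].
  have := near_neq cb B1x; apply: filterS => y ny.
  have [->|/B1 h] := eqVneq (f y) base; first by rewrite tw_base e00 subrr.
  by rewrite h eqxx in ny.
have [d0 d0gt near0] := tube (near_base (cB _) (B0 x) egt0).
have [d1 d1gt near1] := tube (near_base (cB _) B1x egt0).
pose d := Num.min d0 d1; have dgt : 0 < d by rewrite lt_min d0gt.
have dV : 0 < d^-1 by rewrite invr_gt0.
(* Height below [eta] means squared length plus 1 above [2 / e + d^-1 ^+ 2]. Once the suspension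
   coordinate is at most [d^-1], the other coordinates retain more than [2 / e]. *)
pose eta := 2 / (2 / e + d^-1 ^+ 2).
have den : 0 < 2 / e + d^-1 ^+ 2 by rewrite addr_gt0 ?exprn_gt0 ?divr_gt0.
have eta0 : 0 < eta by rewrite divr_gt0.
have nf := near_base (cf x) fx eta0.
near=> y.
have : 1 - f y ord0 ord0 < eta by near: y.
have h0 : forall s, `|s - 0| < d0 -> 1 - B (s, y) ord0 ord0 < e by near: y.
have h1 : forall s, `|s - 1| < d1 -> 1 - B (s, y) ord0 ord0 < e by near: y.
rewrite /tw; case: eqVneq => [_|fy] /=; first by rewrite e00 subrr.
set s := sg _; case: eqVneq => [_|By]; first by rewrite e00 subrr.
rewrite -(ste_height (sf y) fy) => hy.
have [ha hb] := kap_row_le (tailv (ste (f y))) (ste (B (s, y))).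
have [sd|sd] := leP `|ste (f y) ord0 ord0| d^-1; last first.
  apply: le_lt_trans hb _; rewrite ste_height //.
  by have [|] := sg_tail dgt sd; rewrite lt_min => /andP[]; [rewrite -[sg _]subr0|]; auto.
apply: le_lt_trans ha _; move: hy; rewrite -{1}[ste (f y)]consv_tail sqn_consv.
have : ste (f y) ord0 ord0 ^+ 2 <= d^-1 ^+ 2.
  by rewrite -(real_normK (num_real (ste (f y) ord0 ord0))) lerXn2r ?nnegrE // ltW.
have := sqn_ge0 (tailv (ste (f y))).
move: (sqn _ _ _) (ste (f y) _ _) => A t A0 hs.
rewrite /eta ltr_pM2l // ltf_pV2 ?posrE //; last by nra.
move=> h; rewrite ltr_pdivrMr; last by lra.
rewrite mulrC -ltr_pdivrMr //; lra.
Unshelve. all: by end_near. Qed.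
End Twist.

(** * The Whitehead product in coordinates *)

Section Whitehead.
Variable R : realType.
Local Notation sq := (sqn R _).
Local Notation base := (e0 R _).

Lemma kb1_neqP d (v : 'rV[R]_d) : kb 1 v != base <-> forall i, `|v ord0 i| < 1.
Proof.
rewrite kb_neq; split=> [/forallP h i|h]; first by have := h i; rewrite mul1r.
by apply/forallP => i; rewrite mul1r.
Qed.

Lemma box_consv d t (a : 'rV[R]_d) : (forall i, `|consv t a ord0 i| < 1) <->
  `|t| < 1 /\ forall i, `|a ord0 i| < 1.
Proof.
split=> [h|[ht ha] i]; last first.
  by case: (unliftP ord0 i) => [j ->|->]; rewrite ?consvS ?consv0.
split; first by have := h ord0; rewrite consv0.
by move=> i; have := h (lift ord0 i); rewrite consvS.
Qed.

Lemma box_row_mx d1 d2 (v : 'rV[R]_(d1 + d2)) : (forall i, `|v ord0 i| < 1) <->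
  (forall i, `|lsubmx v ord0 i| < 1) /\ forall i, `|rsubmx v ord0 i| < 1.
Proof.
split=> [h|[h1 h2] i]; first by split=> i; rewrite mxE.
by case: (split_ordP i) => j ->; [have := h1 j | have := h2 j]; rewrite mxE.
Qed.

Definition ub (p : R) : R := p / (1 - 1 * `|p|).

Lemma ste_kb1 d (v : 'rV[R]_d) : (forall i, `|v ord0 i| < 1) ->
  ste (kb 1 v) = \row_i ub (v ord0 i).
Proof.
by move=> h; rewrite /kb ifT ?kapK //; apply/forallP => i; rewrite mul1r.
Qed.

Lemma sg_ub p : `|p| < 1 -> sg (ub p) = (1 + p) / 2.
Proof.
rewrite /sg /ub mul1r => p1.
have D0 : 0 < 1 - `|p| by rewrite subr_gt0.
rewrite normrM normfV (gtr0_norm D0); move: D0 p1.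
have [p0|p0] := leP 0 p; first by rewrite ger0_norm // => D0 p1; field; lra.
by rewrite ltr0_norm // => D0 p1; field; lra.
Qed.

Definition c01 (t : R) : R := Num.max 0 (Num.min 1 t).
(* [rr a] is 1 on the unit box and 0 far from it; it truncates a path so as to
   contract it to the base point as the other smash factor leaves its box. *)
Definition rr d (a : 'rV[R]_d) : R := c01 (d%:R + 1 - sq a).
(* The map [u |-> (whX, whY 1)] below traces a commutator Y X Y^-1 X^-1:
   [slotY] increases on [-3, -1], [slotX] increases on [-1, 1], [slotY]
   decreases on [1, 3] and [slotX] decreases on [3, 5]. *)
Definition slotX (u : R) : R := c01 (Num.min ((u + 1) / 2) ((5 - u) / 2)).
Definition slotY (u : R) : R := c01 (Num.min ((u + 3) / 2) ((3 - u) / 2)).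

Lemma c01P t : [\/ t <= 0 /\ c01 t = 0, 1 <= t /\ c01 t = 1 | 0 < t < 1 /\ c01 t = t].
Proof.
rewrite /c01 maxEle minEle; case: (leP 1 t) => t1.
  by rewrite ler01; constructor 2.
by case: (leP 0 t) => t0; [case: (eqVneq t 0) => [->|n0]; [constructor 1|constructor 3; split] |
  constructor 1; split] => //; rewrite ?t1 ?andbT ?lt_neqAle ?t0 1?eq_sym ?n0 ?ltW.
Qed.

Lemma c01_0 t : t <= 0 -> c01 t = 0.
Proof. by case: (c01P t) => -[? ->]; lra. Qed.

Lemma c01_1 t : 1 <= t -> c01 t = 1.
Proof. by case: (c01P t) => -[? ->]; lra. Qed.

Lemma c01_id t : 0 <= t <= 1 -> c01 t = t.
Proof. by case: (c01P t) => -[? ->]; lra. Qed.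

Lemma c01_itv t : 0 <= c01 t <= 1.
Proof. by case: (c01P t) => -[? ->]; lra. Qed.

Lemma box_sqn d (a : 'rV[R]_d) : (forall i, `|a ord0 i| < 1) -> sq a <= d%:R.
Proof.
move=> h; rewrite /sqn -[X in _ <= X%:R]card_ord -sum1_card natr_sum; apply: ler_sum => i _.
by rewrite -(real_normK (num_real (a ord0 i))) exprn_ile1 // ltW.
Qed.

Lemma rr1 d (a : 'rV[R]_d) : (forall i, `|a ord0 i| < 1) -> rr a = 1.
Proof.
by move=> /box_sqn h; apply: c01_1; lra.
Qed.

Lemma rr0 d (a : 'rV[R]_d) : d%:R + 1 <= sq a -> rr a = 0.
Proof. by rewrite /rr; case: (c01P (d%:R + 1 - sq a)) => -[? ->]; lra. Qed.

Lemma rr_ge0 d (a : 'rV[R]_d) : 0 <= rr a.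
Proof. by rewrite /rr; case: (c01P (d%:R + 1 - sq a)) => -[? ->]; lra. Qed.

(** The commutator runs along the edges of a square, so one slot rests at 0 or 1 while the other
    moves. The last case is the edge where X runs forward with Y at 1, the only one on which the
    invariant is nontrivial. *)
Lemma slot_cases u :
  [\/ slotX u = 0, slotY u = 0, slotX u = 1 /\ 1 <= u | [/\ `|u| < 1, slotX u = (u + 1) / 2 & slotY u = 1]].
Proof.
have [u1|u1] := lerP u (-1).
  constructor 1; apply: c01_0; rewrite ge_min; apply/orP; left; lra.
have [u3|u3] := lerP 3 u.
  constructor 2; apply: c01_0; rewrite ge_min; apply/orP; right; lra.
have [u2|u2] := lerP 1 u.
  constructor 3; split=> //; apply: c01_1; rewrite le_min; apply/andP; split; lra.
constructor 4; split; first by rewrite ltr_norml u1.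
  rewrite /slotX min_l; last by lra.
  by apply: c01_id; apply/andP; split; lra.
apply: c01_1; rewrite le_min; apply/andP; split; lra.
Qed.

Lemma slot_box u : `|u| < 1 -> slotX u = (u + 1) / 2 /\ slotY u = 1.
Proof.
rewrite ltr_norml => /andP[u1 u2]; split; last first.
  by apply: c01_1; rewrite le_min; apply/andP; split; lra.
rewrite /slotX min_l; last by lra.
by apply: c01_id; apply/andP; split; lra.
Qed.

Lemma slotX_01 u : 0 <= slotX u <= 1.
Proof. exact: c01_itv. Qed.

Lemma slotY_01 u : 0 <= slotY u <= 1.
Proof. exact: c01_itv. Qed.

Lemma slot_far u : 25 <= u ^+ 2 -> slotX u = 0 /\ slotY u = 0.
Proof.
move=> u2; have [u0|u0] := lerP 0 u.
  have u5 : 5 <= u by nra.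
  by split; apply: c01_0; rewrite ge_min; apply/orP; right; lra.
have u5 : u <= - 5 by nra.
by split; apply: c01_0; rewrite ge_min; apply/orP; left; lra.
Qed.

Variables m q : nat.
Implicit Type v : 'rV[R]_(m + q.+1).

Definition whX v : 'rV[R]_m.+2 :=
  let b := rsubmx v in
  kb 1 (consv (2 * Num.min (slotX (b ord0 ord0)) (rr (tailv b)) - 1) (lsubmx v)).

(* As [t] runs from 0 to 1 this is a path from the base point to the
   Y-component of the Whitehead product at [v]. *)
Definition whY (t : R) v : 'rV[R]_q.+2 :=
  let b := rsubmx v in
  kb 1 (consv (2 * (Num.min (slotY (b ord0 ord0)) (rr (lsubmx v)) * t) - 1) (tailv b)).

Lemma whX_sphere v : sphere R m.+1 (whX v).
Proof. exact: kb_sphere. Qed.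

Lemma whY_sphere t v : sphere R q.+1 (whY t v).
Proof. exact: kb_sphere. Qed.

Lemma whY0 v : whY 0 v = base.
Proof.
apply/eqP; apply: contraT => /kb1_neqP /box_consv[].
by rewrite !mulr0 sub0r normrN normr1 ltxx.
Qed.

Lemma slot_lt (x : R) : `|2 * x - 1| < 1 <-> 0 < x < 1.
Proof. by rewrite ltr_norml; split=> /andP[? ?]; apply/andP; split; lra. Qed.

Lemma wh_disjoint v : whX v != base -> whY 1 v = base.
Proof.
move=> /kb1_neqP /box_consv[/slot_lt hx ha].
apply/eqP; apply: contraT => /kb1_neqP /box_consv[/slot_lt hy hb].
move: hx hy; rewrite (rr1 ha) (rr1 hb) mulr1.
set u := rsubmx v _ _; have /andP[x0 x1] := slotX_01 u; have /andP[y0 y1] := slotY_01 u.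
rewrite !min_l //; case: (slot_cases u) => [->|->|[-> _]|[_ _ ->]]; lra.
Qed.

(** A component off the base point has its own coordinates in a box, contributing at most [m] or
    [q]. Either the other factor is so long that [rr] vanishes, or [u ^+ 2] exceeds 26 and both
    slots vanish. This bounded support lets the product extend over infinity. *)
Lemma wh_far v : (m + q)%:R + 27 <= sq v -> whX v = base /\ forall t, whY t v = base.
Proof.
move=> hv; set u := rsubmx v ord0 ord0.
have sv : sq v = sq (lsubmx v) + (u ^+ 2 + sq (tailv (rsubmx v))).
  by rewrite -[v in LHS]hsubmxK sqn_row_mx -[rsubmx v in LHS]consv_tail sqn_consv.
split=> [|t]; apply/eqP; apply: contraT => /kb1_neqP /box_consv[/slot_lt hx ha].
  have bm := box_sqn ha; move: hx; case: (lerP (q%:R + 1) (sq (tailv (rsubmx v)))) => b0.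
    rewrite (rr0 b0) minEle; case: ifP => ?; last by lra.
    by have /andP[] := slotX_01 u; rewrite /u; lra.
  have uf : 25 <= u ^+ 2 by move: hv; rewrite sv natrD; lra.
  have [-> _] := slot_far uf.
  by rewrite min_l ?rr_ge0 // ltxx.
have bm := box_sqn ha; move: hx; case: (lerP (m%:R + 1) (sq (lsubmx v))) => b0.
  rewrite (rr0 b0) min_r ?mul0r ?ltxx //.
  by have /andP[] := slotY_01 u.
have uf : 25 <= u ^+ 2 by move: hv; rewrite sv natrD; lra.
have [_ ->] := slot_far uf.
by rewrite min_l ?rr_ge0 // mul0r ltxx.
Qed.

(** Write [v] as [(a, u, b)]. In the box, [whX v] is the collapse of [(u, a)], whose suspension
    coordinate gives the time [(1 + u) / 2]; at that time [whY] is the collapse of [(u, b)], and the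
    smash of [a] with [(u, b)] is the collapse of [v]. If [tw] is not the base point, both slots are
    positive and [slotX u < 1], which forces [|u| < 1] and puts [v] in the box. *)
Lemma tw_wh v : tw (whX v) (fun t => whY t v) = kb 1 v.
Proof.
set a := lsubmx v; set u := rsubmx v ord0 ord0; set b := tailv (rsubmx v).
have [vb|vb] := eqVneq (kb 1 v) base.
  rewrite /tw; case: eqVneq => // Xn /=; case: eqVneq => // Yn.
  exfalso; move: Xn Yn => /kb1_neqP Xb; have /box_consv[/slot_lt hx ha] := Xb.
  rewrite ste_kb1 // mxE consv0 sg_ub; last by apply/slot_lt.
  rewrite -/u -/b in hx *; set s := Num.min _ _ in hx *.
  rewrite (_ : (1 + _) / 2 = s); last by field.
  move=> Yn.
  have /box_consv[] := (kb1_neqP _).1 Yn => /slot_lt; rewrite -/u -/a -/b => hy hb.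
  have sx : s = slotX u by rewrite /s (rr1 hb) min_l //; have /andP[] := slotX_01 u.
  move: hy hx; rewrite (rr1 ha) min_l ?sx; last by have /andP[] := slotY_01 u.
  case: (slot_cases u) => [->|->|[-> _]|[u1 _ _] _ _]; rewrite ?mul0r ?ltxx //.
    by move=> _; rewrite andbF.
  move: vb => /eqP; apply/negP; apply/kb1_neqP/box_row_mx; split=> //.
  by rewrite -[rsubmx v]consv_tail; apply/box_consv.
have [ha] := (box_row_mx _).1 ((kb1_neqP _).1 vb).
rewrite -{1}[rsubmx v]consv_tail => /box_consv[]; rewrite -/u -/b => u1 hb.
have [xu eu] := slot_box u1.
have u11 := u1; rewrite ltr_norml in u11; have /andP[u2 u3] := u11.
have hX : whX v = kb 1 (consv u a).
  by rewrite /whX -/u -/a -/b (rr1 hb) xu min_l; [congr (kb 1 (consv _ _)); field | lra].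
have hY : whY ((1 + u) / 2) v = kb 1 (consv u b).
  by rewrite /whY -/u -/a -/b (rr1 ha) eu minxx mul1r; congr (kb 1 (consv _ _)); field.
have bX := (box_consv u a).2 (conj u1 ha); have bY := (box_consv u b).2 (conj u1 hb).
rewrite /tw hX (negbTE ((kb1_neqP _).2 bX)) /= ste_kb1 // mxE consv0 sg_ub // hY.
rewrite (negbTE ((kb1_neqP _).2 bY)) /= ste_kb1 //.
rewrite kb_neq in vb; rewrite /kb vb; congr kap.
apply/rowP => i; rewrite [RHS]mxE; case: (split_ordP i) => j ->.
  by rewrite row_mxEl !mxE liftK /= mxE.
rewrite row_mxEr !mxE; case: (unliftP ord0 j) => [k ->|->].
  by rewrite /= !mxE.
by rewrite /= /u !mxE.
Qed.

End Whitehead.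

(** * Homotopies, and the Whitehead product on spheres *)

Section Homotopy.
Variable R : realType.
Local Notation base := (e0 R _).

(* Homotopies are indexed by all of [R], which makes continuity global. *)
Definition hmt (T : topologicalType) d (A : set 'rV[R]_d) (p : 'rV[R]_d)
    (Z : set T) (f g : T -> 'rV[R]_d) : Prop :=
  exists K : R * T -> 'rV[R]_d,
  [/\ continuous K, (forall z, A (K z)), (forall x, K (0, x) = f x),
      (forall x, K (1, x) = g x) & (forall u x, Z x -> K (u, x) = p)].

Lemma c01_cts (T : topologicalType) (f : T -> R) x : continuous_at x f ->
  continuous_at x (fun y => c01 (f y)).
Proof. by move=> cf; rewrite /c01; cts. Qed.

Section Rel.
Variables (T : topologicalType) (d : nat) (A : set 'rV[R]_d) (p : 'rV[R]_d) (Z : set T).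

Lemma hmt_sym f g : hmt A p Z f g -> hmt A p Z g f.
Proof.
move=> [K [cK sK K0 K1 KZ]]; exists (fun z => K (1 - z.1, z.2)); split.
- move=> z; apply: (cts_comp (g := K) (f := fun z : R * T => (1 - z.1, z.2))); [exact: cK | cts].
- by [].
- by move=> x /=; rewrite subr0.
- by move=> x /=; rewrite subrr.
- by move=> u x Zx; apply: KZ.
Qed.

Lemma hmt_trans g f h : hmt A p Z f g -> hmt A p Z g h -> hmt A p Z f h.
Proof.
move=> [K [cK sK K0 K1 KZ]] [L [cL sL L0 L1 LZ]].
exists (fun z => if z.1 - 2^-1 <= 0 then K (2 * z.1, z.2) else L (2 * z.1 - 1, z.2)).
split=> [z|z|x|x|u x Zx].
- apply: (cts_glue (f := fun z : R * T => K (2 * z.1, z.2)) (g := fun z => L (2 * z.1 - 1, z.2)) (l := fun z => z.1 - 2^-1)).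
  + apply: (cts_comp (g := K) (f := fun z : R * T => (2 * z.1, z.2))); [exact: cK | cts].
  + apply: (cts_comp (g := L) (f := fun z : R * T => (2 * z.1 - 1, z.2))); [exact: cL | cts].
  + by cts.
  + move=> z0; rewrite (_ : 2 * z.1 = 1); last by lra.
    by rewrite K1 subrr L0.
- by case: ifP.
- by rewrite /= ifT ?mulr0 ?K0 // sub0r oppr_le0 invr_ge0 ler0n.
- rewrite /= ifF; last by apply/negbTE; rewrite -ltNge; lra.
  have -> : 2 * 1 - 1 = 1 :> R by ring.
  exact: L1.
- by case: ifP; rewrite /= ?KZ ?LZ.
Qed.

End Rel.

(** Near the base point coordinate vectors are longer than any given bound, so the extended map is
    constant there. *)
Lemma cts_ext d k (T : topologicalType) (N : R) (c : T -> 'rV[R]_d.+1)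
    (g : T -> 'rV[R]_d -> 'rV[R]_k.+1) x :
  (forall y, sphere R d (c y)) -> continuous_at x c ->
  (continuous_at x (fun y => ste (c y)) -> continuous_at x (fun y => g y (ste (c y)))) ->
  (forall y v, N <= sqn R _ v -> g y v = base) ->
  continuous_at x (fun y => if c y == base then base else g y (ste (c y))).
Proof.
move=> sc cc cg gN; have [cx|cx] := eqVneq (c x) base; last first.
  apply: (cts_near_eq (g := fun y => g y (ste (c y)))).
    by have := near_neq cc cx; apply: filterS => y /negbTE ->.
  by apply: cg; apply: cts_ste.
apply: (cts_near_cst (c := base)).
have M0 : 0 < Num.max N 0 + 1 by rewrite ltr_wpDl // le_max lexx orbT.
have : 0 < 2 / (Num.max N 0 + 1) by rewrite divr_gt0.
move=> /(near_base cc cx); apply: filterS => y; case: eqVneq => // cy.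
rewrite -ste_height // ltr_pM2l // ltf_pV2 ?posrE ?sqn1_gt0 // ltrD2r gt_max => /andP[/ltW ? _].
exact: gN.
Qed.

Section WhiteheadSphere.
Variables m q : nat.

Definition whsX (x : 'rV[R]_(m + q.+1).+1) : 'rV[R]_m.+2 :=
  if x == base then base else whX (ste x).
Definition whsY t (x : 'rV[R]_(m + q.+1).+1) : 'rV[R]_q.+2 :=
  if x == base then base else whY t (ste x).

Lemma whsX_sphere x : sphere R m.+1 (whsX x).
Proof. by rewrite /whsX; case: ifP => _; [apply: sphere_e0 | apply: whX_sphere]. Qed.

Lemma whsY_sphere t x : sphere R q.+1 (whsY t x).
Proof. by rewrite /whsY; case: ifP => _; [apply: sphere_e0 | apply: whY_sphere]. Qed.

Lemma whsX_base : whsX base = base.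
Proof. by rewrite /whsX eqxx. Qed.

Lemma whsY_base t : whsY t base = base.
Proof. by rewrite /whsY eqxx. Qed.

Lemma whsY0 x : whsY 0 x = base.
Proof. by rewrite /whsY; case: ifP => // _; apply: whY0. Qed.

Lemma whs_disjoint x : whsX x != base -> whsY 1 x = base.
Proof. by rewrite /whsX /whsY; case: ifP => // _; apply: wh_disjoint. Qed.

Lemma tw_whs x : tw (whsX x) (fun t => whsY t x) = kbase 1 x.
Proof.
rewrite /whsX /whsY /kbase; case: ifP => _; first exact: tw_base.
exact: tw_wh.
Qed.

Variable T : topologicalType.
Implicit Type c : T -> 'rV[R]_(m + q.+1).+1.

Lemma cts_whsX c x : (forall y, sphere R _ (c y)) -> continuous_at x c -> continuous_at x (fun y => whsX (c y)).
Proof.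
move=> sc cc; apply: (cts_ext (N := (m + q)%:R + 27) (g := fun y v => whX v)) => //.
  move=> cv; rewrite /whX; set v := fun y => ste (c y) in cv *.
  have cr := cts_rsubmx cv; have ct := cts_tailv cr; have cl := cts_lsubmx cv.
  have cs := cts_sqn ct.
  apply: (cts_kb (th := fun=> 1)); [by move=> _; rewrite ler01 lexx | cts |].
  apply: cts_consv => //; rewrite /slotX /rr /c01; cts.
by move=> _ w /wh_far[].
Qed.

Lemma cts_whsY c (r : T -> R) x : (forall y, sphere R _ (c y)) -> continuous_at x r -> continuous_at x c ->
  continuous_at x (fun y => whsY (r y) (c y)).
Proof.
move=> sc ct cc; apply: (cts_ext (N := (m + q)%:R + 27) (g := fun y v => whY (r y) v)) => //.
  move=> cv; rewrite /whY; set v := fun y => ste (c y) in cv *.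
  have cr := cts_rsubmx cv; have ct' := cts_tailv cr; have cl := cts_lsubmx cv.
  have cs := cts_sqn cl.
  apply: (cts_kb (th := fun=> 1)); [by move=> _; rewrite ler01 lexx | cts |].
  apply: cts_consv => //; rewrite /slotY /rr /c01; cts.
by move=> y w /wh_far[].
Qed.

End WhiteheadSphere.
End Homotopy.

(** * Iterated Whitehead products and their left inverses *)

Section HopfInvariant.
Variable R : realType.
Local Notation base := (e0 R _).

Lemma hmt_sub (T : topologicalType) d (A : set 'rV[R]_d) p (Z Z' : set T) f g :
  (forall x, Z' x -> Z x) -> hmt A p Z f g -> hmt A p Z' f g.
Proof.
move=> ZZ [K [cK sK K0 K1 KZ]]; exists K; split=> // u x /ZZ; exact: KZ.
Qed.

Lemma hmt_tw m q (T : topologicalType) (f : T -> 'rV[R]_m.+2)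
    (B : R -> R * T -> 'rV[R]_q.+1) :
  continuous f -> continuous (fun z : R * (R * T) => B z.1 z.2) ->
  (forall x, sphere R m.+1 (f x)) -> (forall u z, sphere R q (B u z)) ->
  (forall u x, B u (0, x) = base) ->
  (forall u x, f x != base -> B u (1, x) = base) ->
  hmt (sphere R (m + q)) base [set x | f x = base]
    (fun x => tw (f x) (fun s => B 0 (s, x))) (fun x => tw (f x) (fun s => B 1 (s, x))).
Proof.
move=> cf cB sf sB B0 B1.
exists (fun z => tw (f z.2) (fun s => B z.1 (s, z.2))); split=> // [|z|u x /= ->].
- apply: (cts_tw (f := fun z : R * T => f z.2)
    (B := fun y : R * (R * T) => B y.2.1 (y.1, y.2.2))) => // [z|z|z].
  + by apply: (cts_comp (g := f) (f := fun z : R * T => z.2)); [exact: cf | cts].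
  + apply: (cts_comp (g := fun z : R * (R * T) => B z.1 z.2)
      (f := fun y : R * (R * T) => (y.2.1, (y.1, y.2.2)))); [exact: cB | cts].
  + exact: B1.
- exact: tw_sphere.
- exact: tw_base.
Qed.

Lemma hmt_kbase d (T : topologicalType) (c : T -> 'rV[R]_d.+1) :
  continuous c -> (forall x, sphere R d (c x)) ->
  hmt (sphere R d) base [set x | c x = base] (fun x => kbase 1 (c x)) c.
Proof.
move=> cc sc; exists (fun z => kbase (1 - c01 z.1) (c z.2)); split.
- move=> z; apply: (cts_kbase (th := fun z : R * T => 1 - c01 z.1) (c := fun z : R * T => c z.2)).
  + by move=> y; have /andP[? ?] := c01_itv y.1; apply/andP; split; lra.
  + by move=> y; apply: sc.
  + by cts; apply: c01_cts; cts.
  + by apply: (cts_comp (g := c) (f := fun z : R * T => z.2)); [exact: cc | cts].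
- by move=> z; apply: kbase_sphere.
- by move=> x; rewrite /= c01_0 // subr0.
- by move=> x; rewrite /= c01_1 // subrr kbase0.
- by move=> u x /= ->; rewrite kbase_base.
Qed.

(* [w] is an iterated Whitehead product from the q-sphere to a wedge of
   (m+1)-spheres, given by its components; [h] is an invariant of paths in the
   wedge which recovers, up to homotopy, a path [C] in the q-sphere from its
   image under [w]. *)
Record hopf (m q k : nat) (w : 'rV[R]_q.+1 -> nat -> 'rV[R]_m.+2)
    (h : (R -> nat -> 'rV[R]_m.+2) -> 'rV[R]_q.+1) : Prop := Hopf {
  hopf_w_sphere : forall x i, sphere R q x -> sphere R m.+1 (w x i);
  hopf_w_base : forall i, w base i = base;
  hopf_w_disj : forall x i j, w x i != base -> w x j != base -> i = j;
  hopf_w_fin : forall x i, (k <= i)%N -> w x i = base;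
  hopf_w_cts : forall (T : topologicalType) (c : T -> 'rV[R]_q.+1) i,
    continuous c -> (forall x, sphere R q (c x)) -> continuous (fun x => w (c x) i);
  hopf_h_sphere : forall F, (forall s i, sphere R m.+1 (F s i)) -> sphere R q (h F);
  hopf_h_base : forall F, (forall i, F 1 i = base) -> h F = base;
  hopf_h_cts : forall (T : topologicalType) (F : nat -> R * T -> 'rV[R]_m.+2),
    (forall i, continuous (F i)) -> (forall i z, sphere R m.+1 (F i z)) ->
    (forall i x, F i (0, x) = base) ->
    (forall z i j, F i z != base -> F j z != base -> i = j) ->
    continuous (fun x => h (fun s i => F i (s, x)));
  hopf_hw : forall (T : topologicalType) (C : R * T -> 'rV[R]_q.+1),
    continuous C -> (forall z, sphere R q (C z)) -> (forall x, C (0, x) = base) ->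
    hmt (sphere R q) base [set x | C (1, x) = base]
      (fun x => h (fun s i => w (C (s, x)) i)) (fun x => C (1, x)) }.

Lemma hopf_id m : hopf 1 (fun (x : 'rV[R]_m.+2) i => if i == 0%N then x else base)
  (fun F => F 1 0%N).
Proof.
split=> //.
- by move=> x [|i] // _; apply: sphere_e0.
- by case.
- by move=> x [|i] [|j] //=; rewrite eqxx.
- by move=> x [|i].
- by move=> T c [|i] cc _ //= x; apply: cts_cst.
- move=> T F cF _ _ _ x.
  by apply: (cts_comp (g := F 0%N) (f := fun x => (1 : R, x))); [exact: cF | cts].
- move=> T C cC sC C0; exists (fun z => C (1, z.2)); split=> //.
  by move=> z; apply: (cts_comp (g := C) (f := fun z : R * T => (1 : R, z.2))); [exact: cC | cts].
Qed.

(** The new sphere gets index 0. The suspension coordinate of that component is the time [s] at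
    which the rest of the path is stopped, and the stopped path is [F (s' * s)] with [s'] as its new
    time. *)
Lemma hopf_step m q k w h : @hopf m q.+1 k w h -> exists w' h', @hopf m (m + q.+1) k.+1 w' h'.
Proof.
move=> H.
exists (fun x i => if i is i'.+1 then w (whsY 1 x) i' else whsX x).
exists (fun F => tw (F 1 0%N) (fun s => h (fun s' i => F (s' * s) i.+1))).
split.
- move=> x [|i] _; first exact: whsX_sphere.
  by apply: (hopf_w_sphere H); apply: whsY_sphere.
- by case=> [|i]; rewrite ?whsX_base // whsY_base (hopf_w_base H).
- move=> x [|i] [|j] //.
  + by move=> /whs_disjoint ->; rewrite (hopf_w_base H) eqxx.
  + by move=> + /whs_disjoint hx; rewrite hx (hopf_w_base H) eqxx.
  + by move=> hi hj; rewrite (hopf_w_disj H hi hj).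
- by move=> x [|i] // ki; rewrite (hopf_w_fin H).
- move=> T c [|i] cc sc.
  + by move=> x; apply: cts_whsX => //; exact: (cc x).
  + apply: (hopf_w_cts H) => [x|x]; last exact: whsY_sphere.
    by apply: (cts_whsY (r := fun=> 1)) => //; apply: cts_cst.
- by move=> F _; apply: tw_sphere.
- by move=> F F1; rewrite F1 tw_base.
- move=> T F cF sF F0 dF.
  apply: (cts_tw (f := fun x => F 0%N (1, x))
    (B := fun z : R * T => h (fun s' i => F i.+1 (s' * z.1, z.2)))) => //.
  + move=> x; apply: (cts_comp (g := F 0%N) (f := fun x => (1 : R, x))); [exact: cF | cts].
  + apply: (hopf_h_cts H (F := fun i (y : R * (R * T)) => F i.+1 (y.1 * y.2.1, y.2.2))) => //.
    * move=> i y; apply: (cts_comp (g := F i.+1)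
        (f := fun y : R * (R * T) => (y.1 * y.2.1, y.2.2))); [exact: cF | cts].
    * by move=> i x; rewrite mul0r F0.
    * by move=> z i j hi hj; have [] := dF _ _ _ hi hj.
  + by move=> z; apply: (hopf_h_sphere H) => s i; apply: sF.
  + by move=> x; apply: (hopf_h_base H) => i; rewrite mulr0 F0.
  + move=> x nb; apply: (hopf_h_base H) => i; rewrite mulr1.
    by apply/eqP; apply: contraT => nb'; have := dF _ _ _ nb nb'.
- move=> T C cC sC C0.
  have cX : continuous (fun x => whsX (C (1, x))).
    move=> x; apply: (cts_whsX (c := fun x => C (1, x))) => //.
    by apply: (cts_comp (g := C) (f := fun x => (1 : R, x))); [exact: cC | cts].
  have cCc (U : topologicalType) (s : U -> R) (x : U -> T) : continuous s -> continuous x ->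
      continuous (fun y => C (s y, x y)).
    move=> cs cx y; have csy := cs y; have cxy := cx y.
    by apply: (cts_comp (g := C) (f := fun y => (s y, x y))); [exact: cC | cts].
  have XZ x : C (1, x) = base -> whsX (C (1, x)) = base by move=> ->; rewrite whsX_base.
  (* Taking [R * T] as parameter space undoes the inner invariant for all stopping times [y.2.1]
     simultaneously. *)
  have [|||K [cK sK K0 K1 KZ]] := @hopf_hw _ _ _ _ _ H (R * T)%type
    (fun y => whsY 1 (C (y.1 * y.2.1, y.2.2))).
  + move=> y; apply: (cts_whsY (r := fun=> 1) (c := fun y : R * (R * T) => C (y.1 * y.2.1, y.2.2))) => //.
      exact: cts_cst.
    by apply: cCc => z; cts.
  + by move=> y; apply: whsY_sphere.
  + by move=> y; rewrite /= mul0r C0 whsY_base.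
  have cC1 : continuous (fun x => C (1, x)).
    by apply: (cCc _ (fun=> 1) id) => x; [exact: cts_cst | exact: cts_id].
  (* Two linear homotopies lead from [whsY 1 (C (s, x))] to [whsY s (C (1, x))],
     via the diagonal path [whsY s (C (s, x))] so that the value at [s = 0]
     remains the base point throughout. *)
  apply: (hmt_trans _ (hmt_kbase cC1 (fun x => sC (1, x)))).
  apply: hmt_trans; last first.
    rewrite (_ : (fun x => kbase 1 (C (1, x))) =
      fun x => tw (whsX (C (1, x))) (fun s => whsY s (C ((1 - 1) * s + 1, x)))); last first.
      by apply/funext => x; rewrite -tw_whs; congr tw; apply/funext => s; rewrite subrr mul0r add0r.
    apply: hmt_sub XZ (hmt_tw (f := fun x => whsX (C (1, x)))
      (B := fun u z => whsY z.1 (C ((1 - u) * z.1 + u, z.2))) _ _ _ _ _ _) => //.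
    + move=> z; apply: (cts_whsY (r := fun z : R * (R * T) => z.2.1)
        (c := fun z : R * (R * T) => C ((1 - z.1) * z.2.1 + z.1, z.2.2))) => //; first by cts.
      by apply: cCc => y; cts.
    + by move=> x; apply: whsX_sphere.
    + by move=> u z; apply: whsY_sphere.
    + by move=> u x; rewrite whsY0.
    + by move=> u x nb /=; rewrite mulr1 subrK (whs_disjoint nb).
  apply: hmt_trans; last first.
    rewrite (_ : (fun x => tw (whsX (C (1, x))) (fun s => whsY s (C ((1 - 0) * s + 0, x)))) =
      fun x => tw (whsX (C (1, x))) (fun s => whsY (1 - 1 + 1 * s) (C (s, x)))); last first.
      by apply/funext => x; congr tw; apply/funext => s; rewrite subr0 subrr !mul1r add0r addr0.
    apply: hmt_sub XZ (hmt_tw (f := fun x => whsX (C (1, x)))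
      (B := fun u z => whsY (1 - u + u * z.1) (C z)) _ _ _ _ _ _) => //.
    + move=> z; apply: (cts_whsY (r := fun z : R * (R * T) => 1 - z.1 + z.1 * z.2.1)
        (c := fun z : R * (R * T) => C z.2)) => //; first by cts.
      by apply: (cts_comp (g := C) (f := fun z : R * (R * T) => z.2)); [exact: cC | cts].
    + by move=> x; apply: whsX_sphere.
    + by move=> u z; apply: whsY_sphere.
    + by move=> u x; rewrite C0 whsY_base.
    + by move=> u x nb /=; rewrite mulr1 subrK (whs_disjoint nb).
  rewrite (_ : (fun x => tw _ (fun s => whsY (1 - 0 + 0 * s) _)) =
    fun x => tw (whsX (C (1, x))) (fun s => K (1, (s, x)))); last first.
    apply/funext => x; congr tw; apply/funext => s.
    by rewrite K1 /= mul1r mul0r subr0 addr0.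
  rewrite (_ : (fun x => tw _ (fun s => h _)) =
    fun x => tw (whsX (C (1, x))) (fun s => K (0, (s, x)))); last first.
    by apply/funext => x; congr tw; apply/funext => s; rewrite K0.
  (* [K] rests at the base point wherever its path ends there. This covers stopping time 0, by [C0],
     and stopping time 1 where [whsX] is not the base point, by disjointness. *)
  apply: hmt_sub XZ (hmt_tw (f := fun x => whsX (C (1, x)))
      (B := fun u z => K (u, z)) _ _ _ _ _ _) => //.
  + by move=> z; apply: (cts_comp (g := K) (f := fun z : R * (R * T) => (z.1, z.2))); [exact: cK | cts].
  + by move=> x; apply: whsX_sphere.
  + by move=> u x; apply: KZ => /=; rewrite mulr0 C0 whsY_base.
  + by move=> u x nb; apply: KZ => /=; rewrite mulr1 (whs_disjoint nb).
Qed.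

(** The induction starts at dimension [m + 1] and each step adds [m]. Stating the dimension through
    an equation avoids casts between equal dimensions. *)
Lemma hopf_exists m j q : q = (m * j.+1 + 1)%N -> exists k w h, @hopf m q k w h.
Proof.
elim: j q => [|j IH] q ->.
  by rewrite muln1 addn1; exists 1%N; do 2 eexists; apply: hopf_id.
have [k [w [h H]]] := IH (m * j.+1).+1 (esym (addn1 _)).
have [w' [h' H']] := hopf_step H.
by rewrite mulnS -addnA addn1; exists k.+1, w', h'.
Qed.

End HopfInvariant.

(** * The shrinking wedge, its projections, and detection on one family of spheres *)

Section Wedge.
Variable R : realType.
Local Notation sq := (sqn R _).
Local Notation base := (e0 R _).

Section Spheres.
Variable d : nat.
Implicit Types (x : 'rV[R]_d.+1) (i j r : nat) (P : pred nat).

Lemma sqn_cross x (c : R) : sq (x - c *: base) = sq x - 2 * c * x ord0 ord0 + c ^+ 2.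
Proof.
rewrite -[x]consv_tail e0E /sqn !big_ord_recl !mxE unlift_none /= mulr1.
rewrite [in LHS](eq_bigr (fun i : 'I_d => x ord0 (lift ord0 i) ^+ 2)); last first.
  by move=> i _; rewrite !mxE !liftK /= !mxE mulr0 subr0.
rewrite [in RHS](eq_bigr (fun i : 'I_d => x ord0 (lift ord0 i) ^+ 2)); last first.
  by move=> i _; rewrite !mxE liftK /= mxE.
ring.
Qed.

Lemma wsphereE j x : wsphere R d j x <-> sq x = 2 * j%:R^-1 * x ord0 ord0.
Proof.
rewrite /wsphere /= sqn_cross; split=> h; last by rewrite h subrr add0r.
by move: h => /(canRL (addrK _)); rewrite subrr => /eqP; rewrite subr_eq0 => /eqP.
Qed.

Lemma wsphere0 j : wsphere R d j 0.
Proof. by apply/wsphereE; rewrite mxE mulr0 /sqn big1 // => i _; rewrite mxE expr0n. Qed.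

(** Off the wedge point the index is a continuous function of [x]. Hence the spheres meet only at 0,
    and the index is locally constant elsewhere. *)
Lemma wsphere_index j x : (0 < j)%N -> x != 0 -> wsphere R d j x ->
  j%:R = 2 * x ord0 ord0 * (sq x)^-1.
Proof.
move=> j0 nx /wsphereE h; have sx : sq x != 0 by apply: contra nx => /eqP /sqn0P ->.
have jn : j%:R != 0 :> R by rewrite pnatr_eq0 -lt0n.
apply: (mulIf sx); rewrite divfK // {1}h mulrA; field; exact: jn.
Qed.

Lemma wsphere_inj i j x : (0 < i)%N -> (0 < j)%N -> x != 0 ->
  wsphere R d i x -> wsphere R d j x -> i = j.
Proof.
move=> i0 j0 nx hi hj; apply/eqP; rewrite -(eqr_nat R).
by rewrite (wsphere_index i0 nx hi) (wsphere_index j0 nx hj).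
Qed.

Lemma wsphere_coord j x (i : 'I_d.+1) : (0 < j)%N -> wsphere R d j x -> `|x ord0 i| <= 2 * j%:R^-1.
Proof.
move=> j0 /wsphereE h; have c0 := sqn_coord x ord0; have ci := sqn_coord x i.
have J0 : 0 < j%:R^-1 :> R by rewrite invr_gt0 ltr0n.
move: h c0 ci; move: (x ord0 i) (x ord0 ord0) (sq x) (j%:R^-1) J0 => a t s c c0 -> h1 h2.
have h3 : t <= 2 * c by nra.
by rewrite ler_norml; apply/andP; split; nra.
Qed.

(** The reflection sends [e0] to the wedge point. *)
Definition emb j (y : 'rV[R]_d.+1) : 'rV[R]_d.+1 := j%:R^-1 *: (base - y).
Definition unemb j x : 'rV[R]_d.+1 := base - j%:R *: x.

Lemma emb_wsphere j y : sphere R d y -> wsphere R d j (emb j y).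
Proof.
move=> sy; rewrite /wsphere /= /emb scalerBr addrAC subrr sub0r -scaleNr sqnZ sy.
by rewrite mulr1 sqrrN.
Qed.

Lemma emb_base j : emb j base = 0.
Proof. by rewrite /emb subrr scaler0. Qed.

Lemma embK j y : (0 < j)%N -> unemb j (emb j y) = y.
Proof.
move=> j0; rewrite /unemb /emb scalerA mulfV ?pnatr_eq0 -?lt0n // scale1r.
by rewrite opprB addrC subrK.
Qed.

Lemma unemb_sphere j x : (0 < j)%N -> wsphere R d j x -> sphere R d (unemb j x).
Proof.
move=> j0 /wsphereE h; have jn : j%:R != 0 :> R by rewrite pnatr_eq0 -lt0n.
rewrite /sphere /= /unemb (_ : base - j%:R *: x = - j%:R *: (x - j%:R^-1 *: base)).
  by rewrite sqnZ sqn_cross h; field; exact: jn.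
by rewrite scalerBr scalerA mulNr mulfV // scaleN1r opprK addrC scaleNr.
Qed.

Definition Epr P : set 'rV[R]_d.+1 :=
  [set x | exists j, ((0 < j) && P j)%N /\ wsphere R d j x].
Definition wproj P x : 'rV[R]_d.+1 := if `[< Epr P x >] then x else 0.

Lemma bkE k x : bk R d k x = wproj (fun j => (j <= k)%N) x.
Proof. by []. Qed.

Lemma Em0 : Em R d 0.
Proof. by exists 1%N; split=> //; apply: wsphere0. Qed.

Lemma wproj0 P : wproj P 0 = 0.
Proof. by rewrite /wproj; case: ifP. Qed.

Lemma wproj_id P x : Epr P x -> wproj P x = x.
Proof. by rewrite /wproj => /asboolP ->. Qed.

Lemma wproj_out P j x : (0 < j)%N -> wsphere R d j x -> ~~ P j -> wproj P x = 0.
Proof.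
move=> j0 hj nP; have [->|nx] := eqVneq x 0; first exact: wproj0.
rewrite /wproj asboolF // => -[i [/andP[i0 Pi] hi]].
by rewrite (wsphere_inj j0 i0 nx hj hi) Pi in nP.
Qed.

Lemma wproj_Em P x : Em R d x -> Em R d (wproj P x).
Proof. by rewrite /wproj; case: ifP => // _ _; apply: Em0. Qed.

(** At the wedge point, projecting never enlarges a coordinate. Elsewhere the index formula is
    continuous with integer values on E_m, so near [z] the projection is either the identity or
    0. *)
Lemma cts_wproj P (T : topologicalType) (f : T -> 'rV[R]_d.+1) z :
  (forall y, Em R d (f y)) -> continuous_at z f ->
  continuous_at z (fun y => wproj P (f y)).
Proof.
move=> Ef cf; have [fz|fz] := eqVneq (f z) 0.
  apply: cts_row => i; rewrite /continuous_at fz wproj0 mxE.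
  apply/cvgrPdist_lt => e e0.
  have : continuous_at z (fun y => `|f y ord0 i|) by cts.
  move=> /near_lt /(_ (@cts_cst T R^o e z)); rewrite fz mxE normr0 => /(_ e0).
  apply: filterS => y; rewrite sub0r normrN /wproj.
  by case: ifP => // _ _; rewrite mxE normr0.
have [j [j0 hj]] := Ef z.
have cJ : continuous_at z (fun y => `|2 * f y ord0 ord0 * (sq (f y))^-1 - j%:R|).
  have cs := cts_sqn cf.
  have cV : continuous_at z (fun y => (sq (f y))^-1).
    by apply: ctsV => //; apply: contra fz => /eqP /sqn0P ->.
  by cts.
have := near_lt cJ (@cts_cst T R^o 1 z).
rewrite -(wsphere_index j0 fz hj) subrr normr0 ltr01 => /(_ isT) nJ.
have nf := near_neq cf fz.
apply: (cts_near_eq (g := fun y => if P j then f y else 0)); last first.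
  by case: (P j) => //; apply: cts_cst.
near=> y; have fy : f y != 0 by near: y.
have : `|2 * f y ord0 ord0 * (sq (f y))^-1 - j%:R| < 1 by near: y.
have [i [i0 hi]] := Ef y; rewrite -(wsphere_index i0 fy hi) => ij.
have ii : i = j.
  apply/eqP; rewrite eqn_leq; apply/andP; split; rewrite leqNgt; apply/negP => h.
    have : (j.+1)%:R <= i%:R :> R by rewrite ler_nat.
    by move: ij; rewrite ltr_norml -natr1 => /andP[]; lra.
  have : (i.+1)%:R <= j%:R :> R by rewrite ler_nat.
  by move: ij; rewrite ltr_norml -natr1 => /andP[]; lra.
case: ifP => Pj; first by apply: wproj_id; exists i; rewrite i0 ii Pj -ii.
by apply: wproj_out i0 hi _; rewrite ii Pj.
Unshelve. all: by end_near. Qed.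

Definition wcomp r x : 'rV[R]_d.+1 := unemb r (wproj (pred1 r) x).

Lemma wcomp0 r : wcomp r 0 = base.
Proof. by rewrite /wcomp wproj0 /unemb scaler0 subr0. Qed.

Lemma wcomp_sphere r x : (0 < r)%N -> sphere R d (wcomp r x).
Proof.
move=> r0; rewrite /wcomp /wproj; case: ifP => [/asboolP[j [/andP[_ /eqP ->]]]|_].
  exact: unemb_sphere.
exact: unemb_sphere (wsphere0 _).
Qed.

Lemma wcomp_out r j x : (0 < j)%N -> wsphere R d j x -> r != j -> wcomp r x = base.
Proof.
move=> j0 hj rj; have nr : ~~ pred1 r j by rewrite /= eq_sym.
by rewrite /wcomp (wproj_out j0 hj nr) /unemb scaler0 subr0.
Qed.

Lemma wcomp_emb r y : (0 < r)%N -> sphere R d y -> wcomp r (emb r y) = y.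
Proof.
move=> r0 sy; rewrite /wcomp wproj_id ?embK //.
by exists r; rewrite r0 /= eqxx; split=> //; apply: emb_wsphere.
Qed.

Lemma cts_wcomp r (T : topologicalType) (f : T -> 'rV[R]_d.+1) z :
  (forall y, Em R d (f y)) -> continuous_at z f ->
  continuous_at z (fun y => wcomp r (f y)).
Proof.
move=> Ef cf; apply: cts_row => /= i; have cp := cts_wproj (P := pred1 r) Ef cf.
apply: (cts_eq (g := fun y => (base : 'rV[R]_d.+1) ord0 i - r%:R * wproj (pred1 r) (f y) ord0 i)).
  by move=> y; rewrite !mxE.
by cts.
Qed.

End Spheres.

Section Slot.
Variables (m q k : nat) (w : 'rV[R]_q.+1 -> nat -> 'rV[R]_m.+2)
  (h : (R -> nat -> 'rV[R]_m.+2) -> 'rV[R]_q.+1).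
Hypothesis H : hopf k w h.
Variable nu : nat -> nat.
Hypotheses (nu_inj : injective nu) (nu_gt0 : forall t, (0 < nu t)%N).

(** At most one summand is nonzero; writing the map into the wedge as a sum makes its continuity
    immediate. *)
Definition slot_emb (y : 'rV[R]_q.+1) : 'rV[R]_m.+2 :=
  \sum_(t < k) emb (nu t) (w y t).

Lemma slot_emb_base : slot_emb base = 0.
Proof. by rewrite /slot_emb big1 // => t _; rewrite (hopf_w_base H) emb_base. Qed.

Lemma slot_embP y : sphere R q y ->
  (slot_emb y = 0 /\ forall t, w y t = base) \/
  exists t0, [/\ (t0 < k)%N, slot_emb y = emb (nu t0) (w y t0), w y t0 != base &
    forall t, t != t0 -> w y t = base].
Proof.
move=> sy; have [[t0 nt]|ht] := pselect (exists t, w y t != base); last first.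
  have wb t : w y t = base.
    by apply/eqP; apply: contraT => nt; case: ht; exists t.
  by left; split=> //; rewrite /slot_emb big1 // => t _; rewrite wb emb_base.
have wb t : t != t0 -> w y t = base.
  move=> tt; apply/eqP; apply: contraNT tt => tt.
  by rewrite (hopf_w_disj H tt nt).
have tk : (t0 < k)%N.
  by rewrite ltnNge; apply: contra nt => kt; rewrite (hopf_w_fin H) // eqxx.
right; exists t0; split=> //.
rewrite /slot_emb (bigD1 (Ordinal tk)) //= big1 ?addr0 // => t tt.
by rewrite wb ?emb_base //.
Qed.

Lemma slot_emb_wsphere y : sphere R q y ->
  slot_emb y = 0 \/ exists2 t, (t < k)%N & wsphere R m.+1 (nu t) (slot_emb y).
Proof.
move=> sy; have [[-> _]|[t [tk -> _ _]]] := slot_embP sy; first by left.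
by right; exists t => //; apply/emb_wsphere/(hopf_w_sphere H).
Qed.

Lemma wcomp_slot_emb y t : sphere R q y -> wcomp (nu t) (slot_emb y) = w y t.
Proof.
move=> sy; have [[-> ->]|[t0 [tk -> nt wb]]] := slot_embP sy; first exact: wcomp0.
have sw := hopf_w_sphere H t0 sy.
have [->|tt] := eqVneq t t0; first exact: wcomp_emb.
rewrite (wb t tt); apply: wcomp_out (nu_gt0 t0) (emb_wsphere _ sw) _.
by apply: contra tt => /eqP /nu_inj ->.
Qed.

Lemma cts_slot_emb (T : topologicalType) (c : T -> 'rV[R]_q.+1) :
  continuous c -> (forall x, sphere R q (c x)) -> continuous (fun x => slot_emb (c x)).
Proof.
move=> cc sc x; apply: cts_row => i.
have cw t := @hopf_w_cts _ _ _ _ _ _ H T c t cc sc x.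
apply: (cts_eq (g := fun y => \sum_(t < k) ((nu t)%:R^-1 *
   ((base : 'rV[R]_m.+2) ord0 i - w (c y) t ord0 i)))).
  by move=> y; rewrite /slot_emb summxE; apply: eq_bigr => t _; rewrite !mxE.
by apply: cts_sum => t; have ct := cw t; cts.
Qed.

Definition outside n : set 'rV[R]_n := [set x | exists i, ~~ (0 < x ord0 i < 1)].
(** Turns a loop [c] into the path [c (scl s x)], which starts at the base point and reaches [c x]
    at time 1. *)
Definition scl n (s : R) (x : 'rV[R]_n.+1) : 'rV[R]_n.+1 :=
  \row_i (if i == ord0 then s * x ord0 i else x ord0 i).

Lemma scl0_out n (x : 'rV[R]_n.+1) : outside (scl 0 x).
Proof. by exists ord0; rewrite mxE eqxx mul0r ltxx. Qed.

Lemma scl1 n (x : 'rV[R]_n.+1) : scl 1 x = x.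
Proof. by apply/rowP => i; rewrite mxE; case: ifP; rewrite ?mul1r. Qed.

Lemma cts_scl n (T : topologicalType) (s : T -> R) (f : T -> 'rV[R]_n.+1) z :
  continuous_at z s -> continuous_at z f -> continuous_at z (fun y => scl (s y) (f y)).
Proof.
move=> cs cf; apply: (cts_rowE (f := fun i y => if i == ord0 then s y * f y ord0 i else f y ord0 i)) => i.
by case: (i == ord0); cts.
Qed.

(** The homotopy may leave the spheres [nu i]. Its components on them still form paths in a wedge,
    since a nonzero point of E_m lies on one sphere only; so [h] applies to the homotopy and links
    the two recovered loops. *)
Lemma slot_detect n (c c' : 'rV[R]_n.+1 -> 'rV[R]_q.+1) :
  continuous c -> continuous c' ->
  (forall x, sphere R q (c x)) -> (forall x, sphere R q (c' x)) ->
  (forall x, outside x -> c x = base) -> (forall x, outside x -> c' x = base) ->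
  hmt (Em R m.+1) 0 (@outside n.+1) (fun x => slot_emb (c x)) (fun x => slot_emb (c' x)) ->
  hmt (sphere R q) base (@outside n.+1) c c'.
Proof.
move=> cc cc' sc sc' bc bc' [K [cK EK K0 K1 KZ]].
have recover (b : 'rV[R]_n.+1 -> 'rV[R]_q.+1) : continuous b ->
    (forall x, sphere R q (b x)) -> (forall x, outside x -> b x = base) ->
    hmt (sphere R q) base (@outside n.+1)
      (fun x => h (fun s i => w (b (scl s x)) i)) b.
  move=> cb sb bb.
  have [|||L [cL sL L0 L1 LZ]] := @hopf_hw _ _ _ _ _ _ H 'rV[R]_n.+1
    (fun z => b (scl z.1 z.2)).
  - move=> z; apply: (cts_comp (g := b) (f := fun z : R * 'rV[R]_n.+1 => scl z.1 z.2)).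
      exact: cb.
    by apply: cts_scl; cts.
  - by move=> z; apply: sb.
  - by move=> x; apply: bb; apply: scl0_out.
  exists L; split=> // [x|u x ox]; first by rewrite L1 /= scl1.
  by apply: LZ; rewrite /= scl1; apply: bb.
apply: hmt_trans (hmt_sym (recover c cc sc bc)) _.
apply: (hmt_trans _ (recover c' cc' sc' bc')).
(* Here [z.1] is the time along the path and [z.2.1] the parameter of the homotopy. *)
pose F i (z : R * (R * 'rV[R]_n.+1)) := wcomp (nu i) (K (z.2.1, scl z.1 z.2.2)).
have FS i z : sphere R m.+1 (F i z) by apply: wcomp_sphere.
exists (fun y => h (fun s i => F i (s, y))); split.
- apply: (hopf_h_cts H) => //.
  + move=> i z; apply: cts_wcomp => [y|]; first exact: EK.
    apply: (cts_comp (g := K) (f := fun z : R * (R * 'rV[R]_n.+1) => (z.2.1, scl z.1 z.2.2))).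
      exact: cK.
    by apply: cts_pair; [cts | apply: cts_scl; cts].
  + by move=> i y; rewrite /F KZ ?wcomp0 //; apply: scl0_out.
  + move=> z i j; rewrite /F; have [r [r0 hr]] := EK (z.2.1, scl z.1 z.2.2) => hi hj.
    apply: nu_inj; transitivity r; apply/eqP.
      by apply: contraT => ir; rewrite (wcomp_out r0 hr ir) eqxx in hi.
    by apply: contraT; rewrite eq_sym => ir; rewrite (wcomp_out r0 hr ir) eqxx in hj.
- by move=> z; apply: (hopf_h_sphere H) => s i; apply: FS.
- move=> x; congr h; apply/funext => s; apply/funext => i.
  by rewrite /F /= K0 wcomp_slot_emb.
- move=> x; congr h; apply/funext => s; apply/funext => i.
  by rewrite /F /= K1 wcomp_slot_emb.
- move=> u x ox; apply: (hopf_h_base H) => i.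
  by rewrite /F /= scl1 KZ // wcomp0.
Qed.

End Slot.
End Wedge.

(** * Loops on the cube as globally defined maps; sums with disjoint supports *)

Section Cubes.
Variable R : realType.

Lemma cts_eps (T : topologicalType) (f : T -> R) x :
  continuous_at x f <->
  (forall e : R, 0 < e -> \forall y \near x, `|f x - f y| < e).
Proof. by split=> [cf|hf]; apply/cvgrPdist_lt. Qed.

Definition clampv n (x : 'rV[R]_n) : 'rV[R]_n := \row_i c01 (x ord0 i).

Lemma clampv_cube n (x : 'rV[R]_n) : cube R n (clampv x).
Proof. by move=> i; rewrite mxE c01_itv. Qed.

Lemma clampv_id n (x : 'rV[R]_n) : cube R n x -> clampv x = x.
Proof. by move=> cx; apply/rowP => i; rewrite mxE c01_id. Qed.

Lemma c01_out (t : R) : ~~ (0 < t < 1) -> c01 t = 0 \/ c01 t = 1.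
Proof. by case: (c01P t) => -[h ->]; rewrite ?h; [left|right|]. Qed.

Lemma clampv_out n (x : 'rV[R]_n) : outside x -> cube_bd R n (clampv x).
Proof. by move=> [i hi]; exists i; rewrite mxE; apply: c01_out. Qed.

Lemma cube_bd_out n (x : 'rV[R]_n) : cube_bd R n x -> outside x.
Proof. by move=> [i [|] hi]; exists i; rewrite hi ltxx ?andbF. Qed.

Lemma inside_cube n (x : 'rV[R]_n) : ~ outside x -> cube R n x.
Proof.
move=> nx i; have [/andP[? ?]|h] := boolP (0 < x ord0 i < 1); last by case: nx; exists i.
by rewrite !ltW.
Qed.

Lemma cts_clampv n (T : topologicalType) (f : T -> 'rV[R]_n) z :
  continuous_at z f -> continuous_at z (fun y => clampv (f y)).
Proof.
move=> cf; apply: (cts_rowE (f := fun i y => c01 (f y ord0 i))) => i.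
by apply: c01_cts; cts.
Qed.

Lemma within_retract (T S U : topologicalType) (A : set S) (f : S -> U) (r : T -> S) :
  {within A, continuous f} -> continuous r -> (forall z, A (r z)) ->
  continuous (fun z => f (r z)).
Proof.
move=> /subspace_continuousP cf cr Ar z B nB.
have hN : \near z, (A (r z) -> B (f (r z))) := cr z _ (cf _ (Ar z) _ nB).
suff : \near z, B (f (r z)) by [].
by near=> y; have := Ar y; near: y.
Unshelve. all: by end_near. Qed.

(** A loop extended by its base point to the whole space, which avoids subspace topologies; clamping
    the coordinates produces it from a loop on the cube. *)
Definition gloop n d (A : set 'rV[R]_d) (p : 'rV[R]_d) (f : 'rV[R]_n -> 'rV[R]_d) :=
  [/\ continuous f, (forall x, A (f x)) & (forall x, outside x -> f x = p)].

Lemma gloop_nloop n d A p (f : 'rV[R]_n -> 'rV[R]_d) : gloop A p f -> is_nloop R n d A p f.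
Proof.
move=> [cf Af pf]; split=> [|x _|x _ /cube_bd_out]; [|exact: Af|exact: pf].
exact: continuous_subspaceT.
Qed.

Lemma nloop_gloop n d A p (f : 'rV[R]_n -> 'rV[R]_d) : is_nloop R n d A p f ->
  gloop A p (fun x => f (clampv x)).
Proof.
move=> [cf Af pf]; split=> [|x|x ox].
- apply: within_retract cf _ (@clampv_cube n) => x; apply: cts_clampv; exact: cts_id.
- exact: Af (clampv_cube _).
- exact: pf (clampv_cube _) (clampv_out ox).
Qed.

Lemma gloop_clampv n d A p (f : 'rV[R]_n -> 'rV[R]_d) x : gloop A p f ->
  f (clampv x) = f x.
Proof.
move=> [_ _ pf]; have [ox|/inside_cube/clampv_id -> //] := pselect (outside x).
by rewrite !pf //; apply/cube_bd_out/clampv_out.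
Qed.

Lemma hmt_nhtp n d A p (f g : 'rV[R]_n -> 'rV[R]_d) :
  hmt A p (@outside R n) (fun x => f (clampv x)) (fun x => g (clampv x)) -> nhtp R n d A p f g.
Proof.
move=> [K [cK AK K0 K1 KZ]]; exists K; split=> [|t x _ _|x cx|x cx|t x _ _ /cube_bd_out].
- exact: continuous_subspaceT.
- exact: AK.
- by rewrite K0 clampv_id.
- by rewrite K1 clampv_id.
- exact: KZ.
Qed.

Lemma nhtp_hmt n d A p (f g : 'rV[R]_n -> 'rV[R]_d) : nhtp R n d A p f g ->
  hmt A p (@outside R n) (fun x => f (clampv x)) (fun x => g (clampv x)).
Proof.
move=> [H [cH AH H0 H1 HZ]]; exists (fun z => H (c01 z.1, clampv z.2)); split.
- apply: (within_retract (f := H) (r := fun z : R * 'rV[R]_n => (c01 z.1, clampv z.2)) cH) => z.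
    by apply: cts_pair; [apply: c01_cts | apply: cts_clampv]; cts.
  by split; [apply: c01_itv | apply: clampv_cube].
- by move=> z; apply: AH; [apply: c01_itv | apply: clampv_cube].
- by move=> x; rewrite /= c01_0 // H0 //; apply: clampv_cube.
- by move=> x; rewrite /= c01_1 // H1 //; apply: clampv_cube.
- move=> u x ox; apply: HZ (clampv_out ox); [apply: c01_itv | apply: clampv_cube].
Qed.

Lemma hmt_map (T : topologicalType) d e (A : set 'rV[R]_d) (B : set 'rV[R]_e) p Z
    (f g : T -> 'rV[R]_d) (F : 'rV[R]_d -> 'rV[R]_e) :
  (forall (S : topologicalType) (c : S -> 'rV[R]_d), continuous c -> (forall x, A (c x)) ->
     continuous (fun x => F (c x))) -> (forall x, A x -> B (F x)) ->
  hmt A p Z f g -> hmt B (F p) Z (fun x => F (f x)) (fun x => F (g x)).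
Proof.
move=> cF AB [K [cK AK K0 K1 KZ]]; exists (fun z => F (K z)); split.
- exact: cF.
- by move=> z; apply: AB.
- by move=> x; rewrite K0.
- by move=> x; rewrite K1.
- by move=> u x Zx; rewrite KZ.
Qed.

(* Meant for families with disjoint supports; the default value 0 is taken
   where all the [F s x] vanish. *)
Definition dsum (T : Type) d (F : nat -> T -> 'rV[R]_d) (x : T) : 'rV[R]_d :=
  xget 0 [set v | v != 0 /\ exists s, F s x = v].

Section DisjointSum.
Variables (T : Type) (d : nat) (F : nat -> T -> 'rV[R]_d).
Hypothesis dF : forall x s s', F s x != 0 -> F s' x != 0 -> s = s'.

Lemma dsum_eq s x : F s x != 0 -> dsum F x = F s x.
Proof.
move=> ns; apply: xget_unique; first by split=> //; exists s.
by move=> v [nv [s' e]]; rewrite -e in nv *; rewrite (dF nv ns).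
Qed.

Lemma dsumP x : (dsum F x = 0 /\ forall s, F s x = 0) \/
  exists s, [/\ F s x != 0, dsum F x = F s x & forall s', s' != s -> F s' x = 0].
Proof.
have [[s ns]|h] := pselect (exists s, F s x != 0).
  right; exists s; split=> //; first exact: dsum_eq.
  by move=> s' ss; apply/eqP; apply: contraNT ss => ns'; rewrite (dF ns' ns).
have F0 s : F s x = 0 by apply/eqP; apply: contraT => ns; case: h; exists s.
by left; split=> //; apply: xgetPN => v [nv [s e]]; rewrite -e F0 eqxx in nv.
Qed.

Lemma dsum_approx (M : R) S x i : 0 <= M ->
  (forall s, (S <= s)%N -> `|F s x ord0 i| <= M) ->
  `|dsum F x ord0 i - \sum_(s < S) F s x ord0 i| <= M.
Proof.
move=> M0 hM; have [[-> F0]|[s [ns -> F0]]] := dsumP x.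
  by rewrite mxE big1 ?subrr ?normr0 // => s _; rewrite F0 mxE.
have [sS|Ss] := ltnP s S.
  rewrite (bigD1 (Ordinal sS)) //= big1 ?addr0 ?subrr ?normr0 // => t ts.
  by rewrite F0 ?mxE //; apply: contra ts => /eqP e; apply/eqP/val_inj.
rewrite big1 ?subr0; first exact: hM.
move=> t _; rewrite F0 ?mxE //; apply: contraTN Ss => /eqP <-.
by rewrite -ltnNge.
Qed.

End DisjointSum.

Lemma eq_dsum (T T' : Type) d (F : nat -> T -> 'rV[R]_d) (F' : nat -> T' -> 'rV[R]_d) x x' :
  (forall s, F s x = F' s x') -> dsum F x = dsum F' x'.
Proof.
by move=> e; rewrite /dsum; congr xget; apply/seteqP; split=> v [nv [s h]]; split=> //;
  exists s; rewrite -h.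
Qed.

(** A uniform limit of finite sums: by disjointness the remainder is a single term, bounded by
    [2 / S.+1%:R]. *)
Lemma cts_dsum (T : topologicalType) d (F : nat -> T -> 'rV[R]_d) :
  (forall x s s', F s x != 0 -> F s' x != 0 -> s = s') ->
  (forall s, continuous (F s)) ->
  (forall s x i, `|F s x ord0 i| <= 2 / s.+1%:R) -> continuous (dsum F).
Proof.
move=> dF cF bF x; apply: cts_row => i; apply/cts_eps => e e0.
have [S hS] : exists S, 2 / S.+1%:R < e / 4 :> R.
  have := archi_boundP (_ : 0 <= 8 / e); rewrite divr_ge0 ?ltW // => /(_ isT).
  set S := Num.bound _ => hS; exists S.
  rewrite ltr_pdivrMr ?ltr0n // -[S.+1%:R]natr1.
  move: hS; rewrite ltr_pdivrMr //; move: (S%:R) => r; nra.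
have M0 : 0 <= 2 / S.+1%:R :> R by rewrite divr_ge0.
have app y : `|dsum F y ord0 i - \sum_(s < S) F s y ord0 i| <= 2 / S.+1%:R.
  apply: dsum_approx => // s Ss; apply: le_trans (bF _ _ _) _.
  by rewrite ler_pM2l // lef_pV2 ?posrE ?ltr0n // ler_nat ltnS.
move: (2 / S.+1%:R) M0 hS app => M M0 hS app.
have cG : continuous_at x (fun y => \sum_(s < S) F s y ord0 i).
  by apply: cts_sum => s; have cs := cF s x; cts.
have := (cts_eps _ _).1 cG (e / 4); rewrite divr_gt0 // => /(_ isT).
apply: filterS => y; move: (app x) (app y).
by rewrite !ler_norml !ltr_norml => /andP[? ?] /andP[? ?] /andP[? ?]; apply/andP; split; lra.
Qed.

End Cubes.

(** * Infinite sums of loops in the shrinking wedge *)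

Section Sum.
Variables (R : realType) (m n : nat).
Local Notation base := (e0 R _).
Local Notation V := 'rV[R]_n.+2.

(** Unique factorisation into a power of 2 and an odd number makes the families disjoint. As
    [nu s t > s], the spheres of family [s] shrink as [s] grows, which makes infinite sums
    continuous. *)
Definition nu (s t : nat) : nat := (2 ^ s * t.*2.+1)%N.

Lemma nu_gt s t : (s < nu s t)%N.
Proof. by apply: leq_trans (ltn_expl s (ltnSn 1)) _; rewrite leq_pmulr. Qed.

Lemma nu_gt0 s t : (0 < nu s t)%N.
Proof. exact: leq_ltn_trans (leq0n s) (nu_gt s t). Qed.

Lemma nu_inj2 s t s' t' : nu s t = nu s' t' -> s = s' /\ t = t'.
Proof.
have lognu a b : logn 2 (nu a b) = a.
  rewrite /nu lognM ?expn_gt0 // lognX logn_prime // eqxx muln1.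
  rewrite (_ : logn 2 b.*2.+1 = 0%N) ?addn0 //.
  by rewrite logn_coprime // coprime2n /= odd_double.
move=> e; have es : s = s' by rewrite -(lognu s t) e lognu.
split=> //; move: e; rewrite -es => /eqP; rewrite eqn_pmul2l ?expn_gt0 //.
by rewrite eqSS => /eqP /double_inj.
Qed.

Definition slot_set (s k : nat) : set 'rV[R]_m.+2 :=
  [set x | x = 0 \/ exists2 t, (t < k)%N & wsphere R m.+1 (nu s t) x].

Lemma slot_set_Em s k x : slot_set s k x -> Em R m.+1 x.
Proof. by case=> [->|[t _ h]]; [exact: Em0 | exists (nu s t); rewrite nu_gt0]. Qed.

Lemma slot_set_small s k x i : slot_set s k x -> `|x ord0 i| <= 2 / s.+1%:R.
Proof.
case=> [->|[t _ h]]; first by rewrite mxE normr0 divr_ge0.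
apply: le_trans (wsphere_coord i (nu_gt0 s t) h) _.
by rewrite ler_pM2l // lef_pV2 ?posrE ?ltr0n ?nu_gt0 // ler_nat nu_gt.
Qed.

Definition i1 : 'I_n.+2 := lift ord0 ord0.
Definition reparam (f : R -> R) (x : V) : V :=
  \row_i (if i == i1 then f (x ord0 i) else x ord0 i).

(* The s-th summand of an infinite sum occupies the slab
   2^-(s+1) < x_1 < 2^-s; concatenation uses the other coordinate x_0. *)
Definition slab (s : nat) (t : R) : R := 2 ^+ s.+1 * t - 1.

Lemma slab_disj s s' t : 0 < slab s t < 1 -> 0 < slab s' t < 1 -> s = s'.
Proof.
wlog ss : s s' / (s < s')%N => [W h h'|].
  have [ss|ss|//] := ltngtP s s'; first exact: W.
  by apply/esym; apply: W.
rewrite /slab => /andP[h _] /andP[_ h'].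
have : 2 ^+ s.+2 <= 2 ^+ s'.+1 :> R by rewrite ler_eXn2l ?ltr1n.
have p0 : 0 < 2 ^+ s.+1 :> R by rewrite exprn_gt0.
rewrite exprS; move: h h' p0; move: (2 ^+ s.+1) (2 ^+ s'.+1) => a b h h' p0 ab.
have t0 : 0 < t by rewrite -(pmulr_rgt0 _ p0); lra.
have h2 : 2 * a * t <= b * t by rewrite ler_wpM2r // ltW.
by exfalso; lra.
Qed.

Lemma reparam_out (f : R -> R) x :
  (forall t, t <= 0 -> f t <= 0) -> (forall t, 1 <= t -> 1 <= f t) ->
  outside x -> outside (reparam f x).
Proof.
move=> f0 f1 [i hi]; exists i; rewrite mxE; case: ifP => // _.
move: hi; rewrite !negb_and -!leNgt => /orP[h|h]; apply/orP; [left|right]; auto.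
Qed.

Lemma slab_le0 s t : t <= 0 -> slab s t <= 0.
Proof.
rewrite /slab => t0; have : 0 < 2 ^+ s.+1 :> R by rewrite exprn_gt0.
by move: (2 ^+ _) => a a0; nra.
Qed.

Lemma slab_ge1 s t : 1 <= t -> 1 <= slab s t.
Proof.
rewrite /slab => t1; have : 1 <= 2 ^+ s :> R by rewrite exprn_ege1 // ler1n.
by rewrite exprS; move: (2 ^+ _) => a a0; nra.
Qed.

Lemma slab_out s x : outside x -> outside (reparam (slab s) x).
Proof. by apply: reparam_out; [apply: slab_le0 | apply: slab_ge1]. Qed.

Lemma slab_disj_out s s' x : ~ outside (reparam (slab s) x) ->
  ~ outside (reparam (slab s') x) -> s = s'.
Proof.
have key r : ~ outside (reparam (slab r) x) -> 0 < slab r (x ord0 i1) < 1.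
  move=> h; apply: contraT => h'; case: h; exists i1.
  by rewrite mxE eqxx.
by move=> /key h /key; apply: slab_disj h.
Qed.

Lemma cts_reparam (T : topologicalType) (f : T -> R -> R) (g : T -> V) z :
  continuous_at z (fun y => f y (g y ord0 i1)) -> continuous_at z g ->
  continuous_at z (fun y => reparam (f y) (g y)).
Proof.
move=> cf cg; apply: (cts_rowE
  (f := fun i y => if i == i1 then f y (g y ord0 i) else g y ord0 i)) => i.
by case: eqP => [->|_] //; cts.
Qed.

Variable K : nat -> nat.

Definition slot_loops (f : nat -> V -> 'rV[R]_m.+2) : Prop :=
  forall s, gloop (slot_set s (K s)) 0 (f s).
Definition isum (f : nat -> V -> 'rV[R]_m.+2) : V -> 'rV[R]_m.+2 :=
  dsum (fun s x => f s (reparam (slab s) x)).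

Lemma slab_family_disj (T : Type) (X : T -> V) (f : nat -> T -> V -> 'rV[R]_m.+2) :
  (forall s y x, outside x -> f s y x = 0) ->
  forall y s s', f s y (reparam (slab s) (X y)) != 0 ->
    f s' y (reparam (slab s') (X y)) != 0 -> s = s'.
Proof.
move=> f0 y s s' h h'; apply: (@slab_disj_out s s' (X y)) => o.
  by rewrite f0 ?eqxx in h.
by rewrite f0 ?eqxx in h'.
Qed.

Lemma isum_disj f : slot_loops f -> forall x s s',
  f s (reparam (slab s) x) != 0 -> f s' (reparam (slab s') x) != 0 -> s = s'.
Proof.
move=> gf; apply: (@slab_family_disj V id (fun s _ => f s)) => s _ x.
by have [_ _] := gf s; apply.
Qed.

Lemma isum_gloop f : slot_loops f -> gloop (Em R m.+1) 0 (isum f).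
Proof.
move=> gf; have dF := isum_disj gf; split.
- apply: cts_dsum => // [s x|s x i].
    have [cf _ _] := gf s.
    apply: (cts_comp (g := f s) (f := fun x => reparam (slab s) x)); first exact: cf.
    by apply: (cts_reparam (f := fun=> slab s)); rewrite ?/slab; cts.
  by have [_ Sf _] := gf s; apply: slot_set_small (Sf _).
- move=> x; have [[h _]|[s [_ h _]]] := dsumP dF x; rewrite /isum h; first exact: Em0.
  by have [_ Sf _] := gf s; apply: slot_set_Em (Sf _).
- move=> x ox; have [[h _]|[s [_ h _]]] := dsumP dF x; rewrite /isum h //.
  by have [_ _ -> //] := gf s; apply: slab_out.
Qed.

(** Each homotopy stays in its own slot, so the bound [2 / s.+1%:R] holds at all times and the
    homotopies can be summed. *)
Lemma isum_hmt f g : slot_loops f -> slot_loops g ->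
  (forall s, hmt (slot_set s (K s)) 0 (@outside R n.+2) (f s) (g s)) ->
  hmt (Em R m.+1) 0 (@outside R n.+2) (isum f) (isum g).
Proof.
move=> gf gg /choice[H HH].
pose F s (z : R * V) := H s (z.1, reparam (slab s) z.2).
have dF : forall z s s', F s z != 0 -> F s' z != 0 -> s = s'.
  apply: (@slab_family_disj (R * V) snd (fun s z x => H s (z.1, x))) => s z x ox.
  by have [_ _ _ _] := HH s; apply.
exists (dsum F); split.
- apply: cts_dsum => // [s z|s z i].
    have [cH _ _ _ _] := HH s.
    apply: (cts_comp (g := H s) (f := fun z : R * V => (z.1, reparam (slab s) z.2))).
      exact: cH.
    apply: cts_pair; first by cts.
    by apply: (cts_reparam (f := fun=> slab s)); rewrite ?/slab; cts.
  by have [_ SH _ _ _] := HH s; apply: slot_set_small (SH _).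
- move=> z; have [[h _]|[s [_ h _]]] := dsumP dF z; rewrite h; first exact: Em0.
  by have [_ SH _ _ _] := HH s; apply: slot_set_Em (SH _).
- by move=> x; apply: eq_dsum => s; have [_ _ H0 _ _] := HH s; apply: H0.
- by move=> x; apply: eq_dsum => s; have [_ _ _ H1 _] := HH s; apply: H1.
- move=> u x ox; have [[h _]|[s [_ h _]]] := dsumP dF (u, x); rewrite h //.
  by have [_ _ _ _ HZ] := HH s; apply: HZ; apply: slab_out.
Qed.

Definition slot_pred (s : nat) : pred nat :=
  fun j => `[< exists2 t, (t < K s)%N & j = nu s t >].

(** A slot has finitely many spheres, so a large [k] retains all of them; projecting to the slot
    then kills every other summand. *)
Lemma wproj_isum f s k x : slot_loops f -> (forall t, (t < K s)%N -> (nu s t <= k)%N) ->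
  wproj (slot_pred s) (bk R m.+1 k (isum f x)) = f s (reparam (slab s) x).
Proof.
move=> gf hk; have dF := isum_disj gf; rewrite bkE /isum.
have [[-> ->]|[s0 [ns -> h0]]] := dsumP dF x; first by rewrite !wproj0.
have [_ /(_ (reparam (slab s0) x)) Sf _] := gf s0.
case: Sf => [e|[t tk ht]]; first by rewrite e eqxx in ns.
have [e|ss] := eqVneq s s0.
  subst s0.
  rewrite (@wproj_id _ _ (fun j => (j <= k)%N)); last first.
    by exists (nu s t); rewrite nu_gt0 hk.
  apply: wproj_id; exists (nu s t); split=> //; rewrite nu_gt0.
  by apply/asboolP; exists t.
rewrite (h0 s ss); have np : ~~ slot_pred s (nu s0 t).
  by apply/asboolP => -[t' _ /nu_inj2[e _]]; rewrite e eqxx in ss.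
have [e|e] : wproj (fun j => (j <= k)%N) (f s0 (reparam (slab s0) x)) =
    f s0 (reparam (slab s0) x) \/
    wproj (fun j => (j <= k)%N) (f s0 (reparam (slab s0) x)) = 0.
  by rewrite /wproj; case: ifP; auto.
  rewrite e; exact: wproj_out (nu_gt0 _ _) ht np.
rewrite e; exact: wproj0.
Qed.

(** Linear interpolation from [slab s] to the identity; every stage preserves [t <= 0] and [1 <= t],
    hence the outside of the cube. *)
Lemma reparam_hmt f s : slot_loops f ->
  hmt (Em R m.+1) 0 (@outside R n.+2) (fun x => f s (reparam (slab s) x)) (f s).
Proof.
move=> gf; have [cf Sf f0] := gf s.
exists (fun z => f s (reparam (fun t => (1 - c01 z.1) * slab s t + c01 z.1 * t) z.2)).
split.
- move=> z; apply: (cts_comp (g := f s) (f := fun z : R * V => reparam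
    (fun t => (1 - c01 z.1) * slab s t + c01 z.1 * t) z.2)); first exact: cf.
  have cc : continuous_at z (fun z : R * V => c01 z.1) by apply: c01_cts; cts.
  apply: (cts_reparam (g := snd)
    (f := fun z t => (1 - c01 z.1) * slab s t + c01 z.1 * t)); rewrite ?/slab; cts.
- by move=> z; apply: slot_set_Em (Sf _).
- move=> x; congr (f s); apply/rowP => i; rewrite !mxE /= c01_0 //.
  by rewrite subr0 mul1r mul0r addr0.
- move=> x; congr (f s); apply/rowP => i; rewrite !mxE /= c01_1 //.
  by rewrite subrr mul1r mul0r add0r; case: ifP.
- move=> u x ox; apply: f0; apply: reparam_out ox => t ht /=.
    have := slab_le0 s ht; have := c01_itv u; move: (slab s t) (c01 u) => a b /andP[]; nra.
  have := slab_ge1 s ht; have := c01_itv u; move: (slab s t) (c01 u) => a b /andP[]; nra.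
Qed.

Lemma bk_Xle k (x : 'rV[R]_m.+2) : Xle R m.+1 k (bk R m.+1 k x).
Proof.
by rewrite /bk; case: ifP => [/asboolP h|_]; [right | left].
Qed.

Lemma Xle_Em k (x : 'rV[R]_m.+2) : Xle R m.+1 k x -> Em R m.+1 x.
Proof. by case=> [->|[j [/andP[j0 _] h]]]; [exact: Em0 | exists j]. Qed.

Lemma isum_detect f g s : slot_loops f -> slot_loops g ->
  (forall k, nhtp R n.+2 m.+2 (Xle R m.+1 k) 0
    (bk R m.+1 k \o isum f) (bk R m.+1 k \o isum g)) ->
  hmt (Em R m.+1) 0 (@outside R n.+2) (f s) (g s).
Proof.
move=> gf gg hk; pose k := (\max_(t < K s) nu s t)%N.
have kP t : (t < K s)%N -> (nu s t <= k)%N.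
  by move=> tk; apply: (leq_bigmax (F := fun t : 'I_(K s) => nu s t) (Ordinal tk)).
have := nhtp_hmt (hk k).
move=> /(@hmt_map R _ _ _ _ (Em R m.+1) _ _ _ _ (wproj (slot_pred s))).
rewrite wproj0 => H; have {H} : hmt (Em R m.+1) 0 (@outside R n.+2)
    (fun x => f s (reparam (slab s) x)) (fun x => g s (reparam (slab s) x)).
  have e (f' : nat -> V -> 'rV[R]_m.+2) : slot_loops f' ->
      (fun x => f' s (reparam (slab s) x)) =
      fun x => wproj (slot_pred s) ((bk R m.+1 k \o isum f') (clampv x)).
    move=> gf'; apply/funext => x /=; rewrite (gloop_clampv x (isum_gloop gf')).
    by rewrite (wproj_isum _ gf' kP).
  rewrite (e f) // (e g) //; apply: H.
    by move=> S c cc Xc x; apply: cts_wproj (cc x) => y; apply: Xle_Em (Xc y).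
  by move=> x /Xle_Em; apply: wproj_Em.
move=> h; apply: hmt_trans (hmt_sym (reparam_hmt s gf)) _.
exact: hmt_trans h (reparam_hmt s gg).
Qed.

Lemma bk_nhtp k (f g : V -> 'rV[R]_m.+2) : nhtp R n.+2 m.+2 (Em R m.+1) 0 f g ->
  nhtp R n.+2 m.+2 (Xle R m.+1 k) 0 (bk R m.+1 k \o f) (bk R m.+1 k \o g).
Proof.
move=> /nhtp_hmt /(@hmt_map R _ _ _ _ (Xle R m.+1 k) _ _ _ _ (bk R m.+1 k)) H.
apply: hmt_nhtp; rewrite -[X in hmt _ X](wproj0 R m.+1 (fun j => (j <= k)%N)).
apply: H => [S c cc Ec x|x _]; last exact: bk_Xle.
exact: cts_wproj (cc x).
Qed.

End Sum.

(** * Concatenation of globally defined loops *)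

Section Concat.
Variables (R : realType) (n : nat).
Local Notation V := 'rV[R]_n.+2.

Lemma fcoordE (x : V) : fcoord R n.+2 x = x ord0 ord0.
Proof.
rewrite /fcoord (bigD1 ord0) //= big1 ?addr0 // => i /andP[/eqP i0 ni].
by case/eqP: ni; apply: val_inj.
Qed.

Lemma set_fcoord0 (x : V) t : set_fcoord R n.+2 x t ord0 ord0 = t.
Proof. by rewrite mxE. Qed.

Lemma set_fcoordS (x : V) t i : i != ord0 -> set_fcoord R n.+2 x t ord0 i = x ord0 i.
Proof. by move=> ni; rewrite mxE ifF //; apply/negbTE; apply: contra ni => /eqP h; apply/eqP/val_inj. Qed.

Lemma concat_map d e (F : 'rV[R]_d -> 'rV[R]_e) f g x :
  F (concat R n.+2 d f g x) = concat R n.+2 e (fun y => F (f y)) (fun y => F (g y)) x.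
Proof. by rewrite /concat; case: ifP. Qed.

Lemma set_fcoord_clampv (x : V) s t : c01 s = t ->
  set_fcoord R n.+2 (clampv x) t = clampv (set_fcoord R n.+2 x s).
Proof. by move=> st; apply/rowP => i; rewrite !mxE; case: ifP. Qed.

Lemma concat_clampv d (f g : V -> 'rV[R]_d) (x : V) : 0 <= x ord0 ord0 <= 1 ->
  concat R n.+2 d f g (clampv x) =
  concat R n.+2 d (fun y => f (clampv y)) (fun y => g (clampv y)) x.
Proof.
move=> x01; have /andP[x0 x1] := x01.
rewrite /concat !fcoordE mxE c01_id //; case: ifP => h.
  rewrite (@set_fcoord_clampv x (2 * x ord0 ord0)) // c01_id //.
  by apply/andP; split; lra.
have {}h : 2^-1 < x ord0 ord0 by rewrite ltNge h.
rewrite (@set_fcoord_clampv x (2 * x ord0 ord0 - 1)) // c01_id //.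
by apply/andP; split; lra.
Qed.

Lemma cts_set_fcoord (f : R -> R) (x : V) : continuous_at (x ord0 ord0) f ->
  continuous_at x (fun y : V => set_fcoord R n.+2 y (f (y ord0 ord0))).
Proof.
move=> cf; have cc : continuous_at x (fun y : V => f (y ord0 ord0)).
  by apply: (cts_comp (g := f) (f := fun y : V => y ord0 ord0)); cts.
apply: cts_row => i; apply: (cts_eq (g := fun y : V =>
  if val i == 0%N then f (y ord0 ord0) else y ord0 i)) => [y|]; first by rewrite mxE.
by case: (val i == 0%N); cts.
Qed.

Lemma concat_gloop d A p (f g : V -> 'rV[R]_d) :
  gloop A p f -> gloop A p g -> gloop A p (concat R n.+2 d f g).
Proof.
move=> [cf Af pf] [cg Ag pg]; split=> [x|x|x ox].
- apply: (cts_eq (g := fun y : V => if y ord0 ord0 - 2^-1 <= 0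
    then f (set_fcoord R n.+2 y (2 * y ord0 ord0))
    else g (set_fcoord R n.+2 y (2 * y ord0 ord0 - 1)))).
    by move=> y; rewrite /concat !fcoordE subr_le0.
  apply: (cts_glue (f := fun y : V => f (set_fcoord R n.+2 y (2 * y ord0 ord0)))
    (g := fun y : V => g (set_fcoord R n.+2 y (2 * y ord0 ord0 - 1)))
    (l := fun y : V => y ord0 ord0 - 2^-1)).
  + apply: (cts_comp (g := f) (f := fun y : V => set_fcoord R n.+2 y (2 * y ord0 ord0))).
      exact: cf.
    by apply: (cts_set_fcoord (f := fun t => 2 * t)); cts.
  + apply: (cts_comp (g := g) (f := fun y : V => set_fcoord R n.+2 y (2 * y ord0 ord0 - 1))).
      exact: cg.
    by apply: (cts_set_fcoord (f := fun t => 2 * t - 1)); cts.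
  + by cts.
  + move=> h; rewrite pf ?pg //; exists ord0; rewrite set_fcoord0.
      by rewrite (_ : 2 * _ - 1 = 0) ?ltxx //; lra.
    by rewrite (_ : 2 * _ = 1) ?ltxx ?andbF //; lra.
- by rewrite /concat; case: ifP.
- rewrite /concat fcoordE; case: ifP => h.
    have {}h : x ord0 ord0 <= 2^-1 by [].
    apply: pf; move: ox => [i hi]; exists i.
    have [e|ni] := eqVneq i ord0; last by rewrite set_fcoordS.
    rewrite e in hi *; rewrite set_fcoord0; apply: contra hi => /andP[? ?].
    by apply/andP; split; lra.
  have {}h : 2^-1 < x ord0 ord0 by rewrite ltNge h.
  apply: pg; move: ox => [i hi]; exists i.
  have [e|ni] := eqVneq i ord0; last by rewrite set_fcoordS.
  rewrite e in hi *; rewrite set_fcoord0; apply: contra hi => /andP[? ?].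
  by apply/andP; split; lra.
Qed.

(** The two operations act on different coordinates. *)
Lemma concat_reparam d (F : R -> R) (f g : V -> 'rV[R]_d) (x : V) :
  concat R n.+2 d f g (reparam F x) =
  concat R n.+2 d (fun y => f (reparam F y)) (fun y => g (reparam F y)) x.
Proof.
have e t : set_fcoord R n.+2 (reparam F x) t = reparam F (set_fcoord R n.+2 x t).
  by apply/rowP => i; rewrite !mxE; case: (i =P i1 n) => [->|_].
by rewrite /concat !fcoordE mxE !e.
Qed.

End Concat.

(** * Loops carried by a single slot *)

Section SlotLoops.
Variables (R : realType) (m n q k : nat).
Variables (w : 'rV[R]_q.+1 -> nat -> 'rV[R]_m.+2)
  (h : (R -> nat -> 'rV[R]_m.+2) -> 'rV[R]_q.+1).
Hypothesis H : hopf k w h.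
Local Notation base := (e0 R _).
Local Notation V := 'rV[R]_n.+2.
Variable s : nat.
Implicit Type c : V -> 'rV[R]_q.+1.

Definition slot_loop c (x : V) : 'rV[R]_m.+2 := slot_emb k w (nu s) (c (clampv x)).

Lemma slot_emb_set y : sphere R q y -> slot_set s k (slot_emb k w (nu s) y).
Proof. exact: (slot_emb_wsphere H). Qed.

Lemma slot_loop_gloop c : is_nloop R n.+2 q.+1 (sphere R q) base c ->
  gloop (slot_set s k) 0 (slot_loop c).
Proof.
move=> /nloop_gloop[cc sc bc]; split=> [|x|x ox].
- exact: (cts_slot_emb H (nu := nu s) cc sc).
- exact: slot_emb_set.
- by rewrite /slot_loop bc // (slot_emb_base H).
Qed.

Lemma slot_loop_hmt c c' : nhtp R n.+2 q.+1 (sphere R q) base c c' ->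
  hmt (slot_set s k) 0 (@outside R n.+2) (slot_loop c) (slot_loop c').
Proof.
move=> /nhtp_hmt /(@hmt_map R _ _ _ _ (slot_set s k) _ _ _ _ (slot_emb k w (nu s))).
rewrite (slot_emb_base H); apply; last exact: slot_emb_set.
by move=> S c0; apply: (cts_slot_emb H).
Qed.

Lemma slot_loop_inj c c' : is_nloop R n.+2 q.+1 (sphere R q) base c ->
  is_nloop R n.+2 q.+1 (sphere R q) base c' ->
  hmt (Em R m.+1) 0 (@outside R n.+2) (slot_loop c) (slot_loop c') ->
  nhtp R n.+2 q.+1 (sphere R q) base c c'.
Proof.
move=> /nloop_gloop[cc sc bc] /nloop_gloop[cc' sc' bc'] hh; apply: hmt_nhtp.
apply: (slot_detect H (nu := nu s)) => //; last by move=> t; apply: nu_gt0.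
by move=> t t' /nu_inj2[].
Qed.

Lemma slot_loop_concat c c' (x : V) : 0 <= x ord0 ord0 <= 1 ->
  slot_loop (concat R n.+2 q.+1 c c') x =
  concat R n.+2 m.+2 (slot_loop c) (slot_loop c') x.
Proof. by move=> x01; rewrite /slot_loop concat_clampv // concat_map. Qed.

End SlotLoops.

(** * The embedding of the group and its injectivity under Psi *)

Section Embedding.
Variables (R : realType) (m n : nat).
Local Notation base := (e0 R _).
Local Notation V := 'rV[R]_n.+2.
Local Notation G := (Gtype R n.+2 m.+1).
Local Notation q j := ((m.+1 - 1) * j + 1)%N.

(** For each [j]: a bound on the indices of the spheres used, the Whitehead product, and its left
    inverse. *)
Variable W : forall j, nat * ('rV[R]_(q j).+1 -> nat -> 'rV[R]_m.+2) *
  ((R -> nat -> 'rV[R]_m.+2) -> 'rV[R]_(q j).+1).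
Hypothesis HW : forall j, (0 < j)%N -> hopf (W j).1.1 (W j).1.2 (W j).2.

(* The slot coded by (j, i, l) carries the component [g.2 j i l] for j >= 2;
   for j = 0 it carries [g.1 i], redundantly for every l. *)
Definition slot_code (s : nat) : option (nat * nat * nat) := unpickle s.
Definition slot_size (s : nat) : nat :=
  if slot_code s is Some (j, i, l) then if j == 0%N then 1%N else (W j).1.1 else 0%N.
Definition slot_part (g : G) (s : nat) : V -> 'rV[R]_m.+2 :=
  if slot_code s is Some (j, i, l) then
    if j == 0%N then
      slot_loop 1 (fun (x : 'rV[R]_m.+2) t => if t == 0%N then x else base) s (g.1 i)
    else if jrange n.+2 m.+1 j then slot_loop (W j).1.1 (W j).1.2 s (g.2 j i l)
    else fun _ => 0
  else fun _ => 0.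

Lemma jrange_gt0 j : jrange n.+2 m.+1 j -> (0 < j)%N.
Proof. by move=> /andP[j2 _]; apply: leq_trans j2. Qed.

Lemma slot0 s k : slot_set s k (0 : 'rV[R]_m.+2).
Proof. by left. Qed.

Lemma gloop0 s k : gloop (slot_set s k) 0 (fun _ : V => 0 : 'rV[R]_m.+2).
Proof. by split=> [x|x|//]; [exact: cts_cst | exact: slot0]. Qed.

Lemma hmt_refl (A : set 'rV[R]_m.+2) (f : V -> 'rV[R]_m.+2) : gloop A 0 f ->
  hmt A 0 (@outside R n.+2) f f.
Proof.
move=> [cf Af f0]; exists (fun z => f z.2); split=> [z|z|x|x|u x ox] //; last exact: f0.
by apply: (cts_comp (g := f) (f := fun z : R * V => z.2)); [exact: cf | cts].
Qed.

Lemma slot_part_loops g : G_valid R n.+2 m.+1 g -> slot_loops slot_size (slot_part g).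
Proof.
move=> [g1 g2] s; rewrite /slot_size /slot_part.
case: (slot_code s) => [[[j i] l]|]; last exact: gloop0.
case: (j == 0%N); first exact: (slot_loop_gloop (hopf_id R m) s (g1 i)).
case: ifP => jr; last exact: gloop0.
exact: (slot_loop_gloop (HW (jrange_gt0 jr)) s ((g2 j jr).1 i l)).
Qed.

Lemma slot_part_hmt g h s : G_eq R n.+2 m.+1 g h ->
  hmt (slot_set s (slot_size s)) 0 (@outside R n.+2) (slot_part g s) (slot_part h s).
Proof.
move=> [h1 h2]; rewrite /slot_size /slot_part.
case: (slot_code s) => [[[j i] l]|]; last exact/hmt_refl/gloop0.
case: (j == 0%N); first exact: (slot_loop_hmt (hopf_id R m) s (h1 i)).
case: ifP => jr; last exact/hmt_refl/gloop0.
exact: (slot_loop_hmt (HW (jrange_gt0 jr)) s (h2 j jr i l)).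
Qed.

Lemma slot_part_inj g h : G_valid R n.+2 m.+1 g -> G_valid R n.+2 m.+1 h ->
  (forall s, hmt (Em R m.+1) 0 (@outside R n.+2) (slot_part g s) (slot_part h s)) ->
  G_eq R n.+2 m.+1 g h.
Proof.
move=> [g1 g2] [h1 h2] hs; split=> [i|j jr i l].
  have := hs (pickle (0%N, i, 0%N)); rewrite /slot_part /slot_code pickleK /=.
  exact: (slot_loop_inj (hopf_id R m) (g1 i) (h1 i)).
have j0 := jrange_gt0 jr.
have jn : (j == 0)%N = false by apply/negbTE; rewrite -lt0n.
have := hs (pickle (j, i, l)); rewrite /slot_part /slot_code pickleK jr jn.
exact: (slot_loop_inj (HW j0) ((g2 j jr).1 i l) ((h2 j jr).1 i l)).
Qed.

Lemma slot_part_concat g h s (x : V) : 0 <= x ord0 ord0 <= 1 ->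
  slot_part (G_add R n.+2 m.+1 g h) s x =
  concat R n.+2 m.+2 (slot_part g s) (slot_part h s) x.
Proof.
move=> x01; rewrite /slot_part; case: (slot_code s) => [[[j i] l]|]; last first.
  by rewrite /concat; case: ifP.
case: (j == 0%N); first exact: slot_loop_concat.
case: ifP => _; first exact: slot_loop_concat.
by rewrite /concat; case: ifP.
Qed.

Definition embedding (g : G) : V -> 'rV[R]_m.+2 := isum (slot_part g).

(** Both loops agree on the cube, since slabs and concatenation use different coordinates; a
    homotopy from the concatenation to itself therefore suffices. *)
Lemma embedding_add g h : G_valid R n.+2 m.+1 g -> G_valid R n.+2 m.+1 h ->
  nhtp R n.+2 m.+2 (Em R m.+1) 0 (embedding (G_add R n.+2 m.+1 g h))
    (concat R n.+2 m.+2 (embedding g) (embedding h)).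
Proof.
move=> vg vh; have lg := isum_gloop (slot_part_loops vg).
have lh := isum_gloop (slot_part_loops vh).
have [K [cK AK K0 K1 KZ]] := hmt_refl (concat_gloop lg lh).
exists K; split=> [|t x _ _|x cx|x _|t x _ _ /cube_bd_out] //; last exact: KZ.
  exact: continuous_subspaceT.
rewrite K0 /embedding /isum /concat.
have e s : slot_part (G_add R n.+2 m.+1 g h) s (reparam (slab s) x) =
    concat R n.+2 m.+2 (fun y => slot_part g s (reparam (slab s) y))
      (fun y => slot_part h s (reparam (slab s) y)) x.
  rewrite slot_part_concat ?concat_reparam // mxE; exact: cx.
by case: ifP => hx; apply: eq_dsum => s; rewrite e /concat hx.
Qed.

End Embedding.

Theorem theorem1p3 (R : realType) (m n : nat) :
  (2 <= m)%N -> (2 * m - 1 < n)%N ->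
  exists phi : Gtype R n m -> ('rV[R]_n -> 'rV[R]_m.+1),
  [/\ (* phi g is an n-loop in (E_m, b_0) *)
      (forall g, G_valid R n m g -> is_nloop R n m.+1 (Em R m) 0 (phi g)),
      (* well defined on classes *)
      (forall g h, G_valid R n m g -> G_valid R n m h -> G_eq R n m g h ->
         nhtp R n m.+1 (Em R m) 0 (phi g) (phi h)),
      (* homomorphism into pi_n(E_m) *)
      (forall g h, G_valid R n m g -> G_valid R n m h ->
         nhtp R n m.+1 (Em R m) 0 (phi (G_add R n m g h)) (concat R n m.+1 (phi g) (phi h))),
      (* injective: G is isomorphic to its image, a subgroup of pi_n(E_m) *)
      (forall g h, G_valid R n m g -> G_valid R n m h ->
         nhtp R n m.+1 (Em R m) 0 (phi g) (phi h) -> G_eq R n m g h) &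
      (* Psi_n is injective on the image *)
      (forall g h, G_valid R n m g -> G_valid R n m h ->
         (forall k, nhtp R n m.+1 (Xle R m k) 0 (bk R m k \o phi g) (bk R m k \o phi h)) ->
         G_eq R n m g h)].
Proof.
case: m => [//|m] m2 mn.
have {m2 mn} : (2 <= n)%N by apply: leq_trans mn; rewrite mulSn; move: m2; case: m.
case: n => [//|[//|n]] _.
have ex j : exists t : nat * ('rV[R]_((m.+1 - 1) * j + 1).+1 -> nat -> 'rV[R]_m.+2) *
    ((R -> nat -> 'rV[R]_m.+2) -> 'rV[R]_((m.+1 - 1) * j + 1).+1),
    (0 < j)%N -> hopf t.1.1 t.1.2 t.2.
  (* A dummy triple at [j = 0], where the slots are served by [hopf_id]. *)
  case: j => [|j]; first by exists (0%N, fun _ _ => 0, fun _ => 0).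
  have [|k [w [h H]]] := @hopf_exists R m j ((m.+1 - 1) * j.+1 + 1); first by rewrite subn1.
  by exists (k, w, h).
pose W j := projT1 (cid (ex j)).
have HW j : (0 < j)%N -> hopf (W j).1.1 (W j).1.2 (W j).2 := projT2 (cid (ex j)).
have psi_inj g h : G_valid R n.+2 m.+1 g -> G_valid R n.+2 m.+1 h ->
    (forall k, nhtp R n.+2 m.+2 (Xle R m.+1 k) 0
      (bk R m.+1 k \o embedding W g) (bk R m.+1 k \o embedding W h)) ->
    G_eq R n.+2 m.+1 g h.
  move=> vg vh hk; apply: (slot_part_inj HW vg vh) => s.
  exact: isum_detect (slot_part_loops HW vg) (slot_part_loops HW vh) hk.
exists (embedding W); split=> // [g vg|g h vg vh gh|g h vg vh|g h vg vh hgh].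
- exact/gloop_nloop/isum_gloop/slot_part_loops.
- have lg := slot_part_loops HW vg; have lh := slot_part_loops HW vh.
  apply: hmt_nhtp; rewrite /embedding.
  rewrite (_ : (fun x => isum _ (clampv x)) = isum (slot_part W g)); last first.
    by apply/funext => x; apply: gloop_clampv (isum_gloop lg).
  rewrite (_ : (fun x => isum _ (clampv x)) = isum (slot_part W h)); last first.
    by apply/funext => x; apply: gloop_clampv (isum_gloop lh).
  by apply: isum_hmt lg lh _ => s; apply: slot_part_hmt.
- exact: embedding_add.
- by apply: psi_inj => // k; apply: bk_nhtp.
Qed.
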